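(* Let $d\ge3$, fix $\varepsilon>0$, let $p\in\mathcal{P}=\{p\in[0,1]^d:\sum_{i=1}^dp_i=1\}$ be arbitrary, and let the initial configuration have law $\pi_p$. For both the $\mathrm{M1}_\varepsilon$ and the $\mathrm{M2}_\varepsilon$ models on $\mathbb{Z}^d$, let $E(t)=\mathbb{E}[|X_t|^2]$ be the mean-square displacement of the walker and $\widehat E(\lambda)=\int_0^\infty E(t)e^{-\lambda t}\,dt$. Then there are constants $C,D>0$ such that $$C\lambda^{-2}\le\widehat E(\lambda)\le D\lambda^{-2}$$ for all sufficiently small $\lambda>0$. Furthermore, there exist constants $C',D'>0$ such that $$C't\le E(t)\le D't\qquad\text{for all sufficiently large }t\ge0.$$ (The constants may depend on $\varepsilon$.)
   Context: Let $\mathbb{Z}^d_\star=\mathbb{Z}^d\cup\{\star\}$, where $\star$ is an extra symbol indexing the arrow in the walker's hand, $\mathcal{E}=\{\pm e_1,\dots,\pm e_d\}$ the canonical unit vectors and their negatives, $\Omega=\mathcal{E}^{\mathbb{Z}^d_\star}$. For $\omega\in\Omega$, $\omega(x)$ is the arrow at displacement $x$ from the walker and $\omega(\star)$ is the hand arrow. Maps on $\Omega$: for $e\in\mathcal{E}$, $\tau_e\omega(x)=\omega(x+e)$ for $x\neq\star$ and $\tau_e\omega(\star)=\omega(\star)$; $\tau_\star\omega(x)=\omega(x+\omega(\star))$ for $x\ne\star$ and $\tau_\star\omega(\star)=\omega(\star)$; the swap $\sigma$ exchanges the values at $0$ and $\star$ and leaves the others unchanged. For a step map $\tau$ put $$T[\tau]f(\omega)=f(\sigma\tau\omega)-f(\omega),\qquad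 \widetilde T[\tau]f(\omega)=\tfrac14 f(\tau\omega)+\tfrac14 f(\sigma\tau\omega)+\tfrac14 f(\tau\sigma\omega)+\tfrac14 f(\sigma\tau\sigma\omega)-f(\omega).$$ Let $U=\frac1{2d}\sum_{e\in\mathcal{E}}\widetilde T[\tau_e]$. The $\mathrm{M1}_\varepsilon$ (resp. $\mathrm{M2}_\varepsilon$) model is the continuous-time jump process $(\eta_t)_{t\ge0}$ on $\Omega$ (environment seen from the walker) with generator $G_\varepsilon=T[\tau_\star]+\varepsilon U$ (resp. $\widetilde G_\varepsilon=\widetilde T[\tau_\star]+\varepsilon U$). The position $X_t\in\mathbb{Z}^d$ of the walker starts at $X_0=0$ and changes whenever a step map is applied: by $e$ when $\tau_e$ is applied, and when $\tau_\star$ is applied, by the arrow in the hand at the moment it is applied (i.e. $\omega(\star)$ in the terms $\tau_\star\omega,\sigma\tau_\star\omega$, and $\omega(0)$ in the terms $\tau_\star\sigma\omega,\sigma\tau_\star\sigma\omega$). For $p\in\mathcal{P}$, $\mu_p$ is the distribution on $\mathcal{E}$ with $\mu_p(e_i)=\mu_p(-e_i)=\tfrac12p_i$, and $\pi_p$ is the product measure on $\Omega$ under which all $\omega(x)$, $x\in\mathbb{Z}^d_\star$, are i.i.d. with law $\mu_p$. Expectations are over the initial configuration and the dynamics; $|\cdot|$ is the Euclidean norm. *)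

(* Defs.v *)
From HB Require Import structures.
From mathcomp Require Import all_boot all_order all_algebra.
From mathcomp Require Import all_classical all_reals all_analysis.
Import Order.TTheory GRing.Theory Num.Theory.
Import numFieldNormedType.Exports.

Set Implicit Arguments.
Unset Strict Implicit.
Unset Printing Implicit Defensive.

Local Open Scope classical_set_scope.
Local Open Scope ring_scope.

(* The arrow (i, b) stands for the unit vector (-1)^b e_i. *)
Definition arrow (d : nat) := ('I_d * bool)%type.

Definition arrow_vec (d : nat) (a : arrow d) : 'rV[int]_d :=
  (-1) ^+ a.2 *: delta_mx ord0 a.1.

(* Z^d with the extra symbol star, which is None. *)
Definition site (d : nat) := option 'rV[int]_d.

Definition env (d : nat) := site d -> arrow d.

Definition env_shift (d : nat) (v : 'rV[int]_d) (om : env d) : env d :=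
  fun x => if x is Some y then om (Some (y + v)) else om None.

Definition env_step (d : nat) (a : arrow d) (om : env d) : env d :=
  env_shift (arrow_vec a) om.

Definition env_step_hand (d : nat) (om : env d) : env d :=
  env_shift (arrow_vec (om None)) om.

Definition env_swap (d : nat) (om : env d) : env d :=
  fun x => match x with
           | None => om (Some 0)
           | Some y => if y == 0 then om None else om (Some y)
           end.

(* Environment together with the position of the walker. The position is not
   a function of the path of the environment, so the step maps and the swap are
   lifted to pairs; a step moves the walker by the vector by which it shifts
   the environment. *)
Definition state (d : nat) := (env d * 'rV[int]_d)%type.

Definition st_step (d : nat) (a : arrow d) (z : state d) : state d :=
  (env_step a z.1, z.2 + arrow_vec a).

Definition st_step_hand (d : nat) (z : state d) : state d :=
  (env_step_hand z.1, z.2 + arrow_vec (z.1 None)).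

Definition st_swap (d : nat) (z : state d) : state d := (env_swap z.1, z.2).

Section Generators.
Variables (R : realType) (d : nat) (S : Type).
Variables (sigma tau_star : S -> S) (tau : arrow d -> S -> S).

Definition T_op (t : S -> S) (f : S -> R) : S -> R :=
  fun z => f (sigma (t z)) - f z.

Definition Tt_op (t : S -> S) (f : S -> R) : S -> R :=
  fun z => 4^-1 * f (t z) + 4^-1 * f (sigma (t z))
         + 4^-1 * f (t (sigma z)) + 4^-1 * f (sigma (t (sigma z))) - f z.

Definition U_op (f : S -> R) : S -> R :=
  fun z => (2 * d)%:R^-1 * \sum_(a : arrow d) Tt_op (tau a) f z.

Definition M1_op (eps : R) (f : S -> R) : S -> R :=
  fun z => T_op tau_star f z + eps * U_op f z.

Definition M2_op (eps : R) (f : S -> R) : S -> R :=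
  fun z => Tt_op tau_star f z + eps * U_op f z.

End Generators.

Inductive model := M1 | M2.

Definition env_generator (R : realType) (d : nat) (m : model) (eps : R) :
    (env d -> R) -> env d -> R :=
  match m with
  | M1 => M1_op (@env_swap d) (@env_step_hand d) (@env_step d) eps
  | M2 => M2_op (@env_swap d) (@env_step_hand d) (@env_step d) eps
  end.

Definition generator (R : realType) (d : nat) (m : model) (eps : R) :
    (state d -> R) -> state d -> R :=
  match m with
  | M1 => M1_op (@st_swap d) (@st_step_hand d) (@st_step d) eps
  | M2 => M2_op (@st_swap d) (@st_step_hand d) (@st_step d) eps
  end.

Lemma generator_env (R : realType) (d : nat) (m : model) (eps : R)
    (f : env d -> R) (z : state d) :
  generator m eps (fun z => f z.1) z = env_generator m eps f z.1.
Proof. by case: m. Qed.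

(* The swapped hand-step moves the walker by the arrow initially at 0. *)
Lemma st_step_hand_swap (d : nat) (z : state d) :
  st_step_hand (st_swap z)
  = (env_step_hand (env_swap z.1), z.2 + arrow_vec (z.1 (Some 0))).
Proof. by []. Qed.

(* e^(tL) f, for an operator L that is bounded for the supremum norm. *)
Definition semigroup (R : realType) (S : Type) (L : (S -> R) -> S -> R)
    (t : R) (f : S -> R) (z : S) : R :=
  limn (series (fun n => t ^+ n / n`!%:R * iter n L f z)).

(* Generators of the product sigma-algebra on the state space. *)
Definition cylinder (d : nat) : set (set (state d)) :=
  [set A | (exists x a, A = [set z | z.1 x = a])
        \/ (exists y, A = [set z | z.2 = y])].

Definition state_measurable_fun (R : realType) (d : nat) (f : state d -> R) :=
  forall B : set R, measurable B -> <<s @cylinder d >> (f @^-1` B).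

Definition history (R : realType) (d : nat) (W : Type) (Z : R -> W -> state d)
    (s : R) : set (set W) :=
  <<s [set A | exists2 u, 0 <= u <= s &
               exists2 B, cylinder B & A = Z u @^-1` B] >>.

(* Z (restricted to times t >= 0) is a Markov jump process with the bounded
   generator L: its paths are right-continuous step functions, and it has the
   Markov property with transition semigroup e^(tL). *)
Record jump_process (R : realType) (d : nat) (L : (state d -> R) -> state d -> R)
    (disp : measure_display) (W : measurableType disp) (P : probability W R)
    (Z : R -> W -> state d) : Prop := JumpProcess {
  jp_measurable : forall t B, 0 <= t -> cylinder B -> measurable (Z t @^-1` B);
  jp_right : forall w t, 0 <= t -> \forall u \near t^'+, Z u w = Z t w;
  jp_left : forall w t, 0 < t -> exists z, \forall u \near t^'-, Z u w = z;
  jp_markov : forall s t (A : set W) (f : state d -> R),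
    0 <= s -> s <= t -> history Z s A ->
    state_measurable_fun f -> (exists K, forall z, `|f z| <= K) ->
    (\int[P]_(w in A) (f (Z t w))%:E
     = \int[P]_(w in A) (semigroup L (t - s) f (Z s w))%:E)%E }.

Definition in_simplex (R : realType) (d : nat) (p : 'I_d -> R) : Prop :=
  (forall i, 0 <= p i <= 1) /\ \sum_(i < d) p i = 1.

Definition mu (R : realType) (d : nat) (p : 'I_d -> R) (a : arrow d) : R :=
  2^-1 * p a.1.

(* Under the law nu, the coordinates om x are i.i.d. with law mu p; this
   determines nu on the product sigma-algebra. *)
Definition is_pi (R : realType) (d : nat) (p : 'I_d -> R)
    (nu : set (env d) -> \bar R) : Prop :=
  forall (s : seq (site d)) (a : site d -> arrow d), uniq s ->
    nu [set om | forall x, x \in s -> om x = a x]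
    = (\prod_(x <- s) mu p (a x))%:E.

Record walk (R : realType) (d : nat) (m : model) (eps : R) (p : 'I_d -> R)
    (disp : measure_display) (W : measurableType disp) (P : probability W R)
    (Z : R -> W -> state d) : Prop := Walk {
  walk_jump : jump_process (generator m eps) P Z;
  walk_init_env : is_pi p (fun A => P [set w | A (Z 0 w).1]);
  walk_init_pos : forall w, (Z 0 w).2 = 0 }.

Definition sqnorm (R : realType) (d : nat) (x : 'rV[int]_d) : R :=
  \sum_(i < d) (x ord0 i)%:~R ^+ 2.

Definition msd (R : realType) (d : nat) (disp : measure_display)
    (W : measurableType disp) (P : probability W R) (Z : R -> W -> state d)
    (t : R) : \bar R :=
  ('E_P[fun w => sqnorm R (Z t w).2])%E.

Definition laplace (R : realType) (F : R -> \bar R) (lambda : R) : \bar R :=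
  (\int[lebesgue_measure]_(t in `[0%R, +oo[) (F t * (expR (- lambda * t))%:E))%E.

(* Main.v *)
Require Import Defs.
From HB Require Import structures.
From mathcomp Require Import all_boot all_order all_algebra.
From mathcomp Require Import all_classical all_reals all_analysis.
From mathcomp Require Import measurable_realfun.
From mathcomp Require Import ring lra zify.
Import Order.TTheory GRing.Theory Num.Theory.
Import numFieldNormedType.Exports.

(** The mean-square displacement satisfies eps t <= E(t) <= D t for every
    t >= 0, and both claims follow, the Laplace transform of t being
    lambda^-2.

    Uniformization. The generator L is a finite combination of terms
    F o A - F, where A is a step conjugated with swaps. For c large enough
    Q = 1 + L / c is therefore the transition operator of a discrete-time
    walk, and e^(tL) is the average of Q^k over a Poisson number k of steps
    of mean ct ([semigroup_poisson]). It is enough to show that the mean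
    e_k of |X_k|^2 for the discrete walk lies between eps k / c and a multiple
    of k. As the Markov property is available for bounded functions, |x|^2 is
    truncated on the way; after k steps the walk is within distance k, so the
    truncation is invisible for bounded k.

    The recursion for e_k. Put th = 1 / c. The operator Q preserves the form
    |x|^2 + 2 th x . f(om) + r(om): starting from |x|^2 one finds
    f_(k+1) = Q f_k + phi with f_0 = 0, where phi is the mean velocity of the
    walker, and, all moves preserving pi_p,
      e_(k+1) = e_k + th (1 + eps) + 2 th^2 <phi', f_k>
    in L^2(pi_p), where phi' is the mean of the arrow just used, given the
    present environment ([iter_sqnorm], [ex_gain_step]). All functions here
    depend on finitely many arrows, so L^2(pi_p) is replaced by the space of
    local functions with its inner product.

    Lower bound. For M2, phi' = phi and expanding |f_(k+1)|^2 bounds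
    2 <phi, f_k> below by an increment of |f_k|^2, up to a term of lower order
    in th. For M1, L = A - 1 + eps U with A an isometry and <phi', f> equals
    <phi, A f>; then |phi|^2 + 2 th <phi, A f_k> is bounded below by the
    increment of th <f_k, (1 - eps U) f_k> ([isometry_step_lower]), and
    |phi|^2 = 1 exactly pays for all the th (1 + eps) except th eps.

    Upper bound. The dissipation of L is at least that of eps U. If
    <phi, f>^2 and <phi', f>^2 are at most K <f, - U f>, then the decrease of
    |f_k|^2 absorbs 2 <phi', f_k> up to a constant
    ([dissipative_step_upper]). The bound by K <f, - U f> is the place where
    d >= 3 enters ([spin_energy_bound]): U moves the arrow at 0 like a simple
    random walk, and the correlations of f with the arrows at the sites of Z^d
    form a function on Z^d whose Dirichlet energy is at most of the order of
    <f, - U f>; transience bounds its value at 0. Transience is used in the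
    form of a unit flow from 0 to infinity with finite energy, supported by a
    three-dimensional octant ([transient_point_bound]). *)

Set Implicit Arguments.
Unset Strict Implicit.
Unset Printing Implicit Defensive.

Local Open Scope classical_set_scope.
Local Open Scope ring_scope.

(** * A flow of finite energy in the octant of Z^3 *)

Section Transience.
Variable R : realType.
Implicit Types (b : nat -> nat -> nat -> R).

Lemma sum_cauchy_schwarz (I : finType) (f g : I -> R) :
  (\sum_i f i * g i) ^+ 2 <= (\sum_i f i ^+ 2) * \sum_i g i ^+ 2.
Proof.
have key (s : seq I) : (\sum_(i <- s) f i * g i) ^+ 2
    <= (\sum_(i <- s) f i ^+ 2) * \sum_(i <- s) g i ^+ 2.
  elim: s => [|i s IH]; first by rewrite !big_nil expr0n mul0r.
  rewrite !big_cons; set A := \sum_(j <- s) f j * g j in IH *.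
  set F := \sum_(j <- s) _ in IH *; set G := \sum_(j <- s) _ in IH *.
  have F0 : 0 <= F by apply: sumr_ge0 => *; exact: sqr_ge0.
  have G0 : 0 <= G by apply: sumr_ge0 => *; exact: sqr_ge0.
  have := sqr_ge0 (f i ^+ 2 * G - g i ^+ 2 * F) => h.
  have h2 : (2 * (f i * g i) * A) ^+ 2 <= (f i ^+ 2 * G + g i ^+ 2 * F) ^+ 2.
    have : (f i * g i) ^+ 2 * A ^+ 2 <= (f i * g i) ^+ 2 * (F * G).
      by apply: ler_wpM2l => //; exact: sqr_ge0.
    nra.
  have h3 : 2 * (f i * g i) * A <= f i ^+ 2 * G + g i ^+ 2 * F.
    have S0 : 0 <= f i ^+ 2 * G + g i ^+ 2 * F.
      by rewrite addr_ge0 // mulr_ge0 ?sqr_ge0.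
    by rewrite leNgt; apply/negP => lt; nra.
  nra.
by have := key (index_enum I).
Qed.

Lemma sum_le_telescope (F G : nat -> R) (N : nat) :
  (forall n, 0 <= G n) -> (forall n, F n <= G n - G n.+1) ->
  \sum_(n < N) F n <= G 0%N.
Proof.
move=> G0 FG; suff : \sum_(n < N) F n <= G 0%N - G N.
  by move/le_trans; apply; rewrite gerBl.
elim: N => [|N IH]; first by rewrite big_ord0 subrr.
rewrite big_ord_recr /=; have := FG N; lra.
Qed.

Lemma sum_shift (F : nat -> R) N : F 0%N = 0 -> F N = 0 ->
  \sum_(x < N) F x.+1 = \sum_(x < N) F x.
Proof.
move=> F0 FN; have : \sum_(x < N.+1) F x = \sum_(x < N.+1) F x by [].
by rewrite {1}big_ord_recl big_ord_recr /= F0 FN add0r addr0.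
Qed.

(** The vertices of level n = x + y + z in the octant number
    (n + 1) (n + 2) / 2. *)
Definition level_mass (n : nat) : R := 2 / ((n%:R + 1) * (n%:R + 2)).

(** Polya's urn: a unit of mass starts at the origin and moves from (x, y, z)
    in each of the three directions with probability proportional to that
    coordinate plus one. The urn is uniform on each level, which gives the flow
    through every edge. The flow is cut off at level N. *)
Definition urn_flow (N n x : nat) : R :=
  if (n < N)%N then level_mass n * ((x%:R + 1) / (n%:R + 3)) else 0.

Definition cube_sum N (F : nat -> nat -> nat -> R) : R :=
  \sum_(x < N) \sum_(y < N) \sum_(z < N) F x y z.

Lemma cube_sumE N F : cube_sum N F =
  \sum_(v : 'I_N * ('I_N * 'I_N)) F v.1 v.2.1 v.2.2.
Proof.
rewrite /cube_sum -(pair_bigA _ (fun (x : 'I_N) (v : 'I_N * 'I_N) => F x v.1 v.2)) /=.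
by apply: eq_bigr => x _; rewrite -(pair_bigA _ (fun y z : 'I_N => F x y z)).
Qed.

Lemma cube_sum_cauchy_schwarz N F G :
  cube_sum N (fun x y z => F x y z * G x y z) ^+ 2 <=
  cube_sum N (fun x y z => F x y z ^+ 2) * cube_sum N (fun x y z => G x y z ^+ 2).
Proof.
rewrite !cube_sumE.
exact: (@sum_cauchy_schwarz _ (fun v : 'I_N * ('I_N * 'I_N) => F v.1 v.2.1 v.2.2)
  (fun v => G v.1 v.2.1 v.2.2)).
Qed.

Lemma cube_sumD N F G :
  cube_sum N (fun x y z => F x y z + G x y z) = cube_sum N F + cube_sum N G.
Proof. by rewrite !cube_sumE -big_split. Qed.

Lemma cube_sumB N F G :
  cube_sum N (fun x y z => F x y z - G x y z) = cube_sum N F - cube_sum N G.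
Proof. by rewrite !cube_sumE -sumrB. Qed.

Lemma eq_cube_sum N F G : (forall x y z, (x < N)%N -> (y < N)%N -> (z < N)%N ->
  F x y z = G x y z) -> cube_sum N F = cube_sum N G.
Proof. by move=> FG; rewrite !cube_sumE; apply: eq_bigr => v _; exact: FG. Qed.

Lemma le_cube_sum N F G : (forall x y z, F x y z <= G x y z) ->
  cube_sum N F <= cube_sum N G.
Proof. by move=> FG; rewrite !cube_sumE; apply: ler_sum => v _. Qed.

(** Mass is conserved strictly between level 0 and level N: the urn sends the
    uniform law of a level to the uniform law of the next one. *)
Lemma urn_flow_divergence N (x y z : nat) : (0 < N)%N ->
  let n := (x + y + z)%N in
  urn_flow N n x + urn_flow N n y + urn_flow N n z -
  (urn_flow N n.-1 x.-1 *+ (0 < x)%N + urn_flow N n.-1 y.-1 *+ (0 < y)%N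
     + urn_flow N n.-1 z.-1 *+ (0 < z)%N)
  = (n == 0%N)%:R - (n == N)%:R * level_mass N.
Proof.
move=> N0 n.
have nE : n%:R = x%:R + y%:R + z%:R :> R by rewrite /n !natrD.
have pr (k m : nat) : urn_flow N m k.-1 *+ (0 < k)%N
   = if (m < N)%N then level_mass m * (k%:R / (m%:R + 3)) else 0.
  case: k => [|k] /=; first by rewrite mulr0n mul0r mulr0 if_same.
  by rewrite mulr1n /urn_flow natr1.
case En : n => [|m] /=.
  have : (x + y + z)%N = 0%N := En.
  move/eqP; rewrite !addn_eq0 => /andP[/andP[/eqP-> /eqP->] /eqP->].
  rewrite /urn_flow /level_mass N0 eq_sym gtn_eqF //= mulr0n mulr1n mul0r; by field.
rewrite !pr //.
have mE : m%:R = n%:R - 1 :> R by rewrite En -natr1; ring.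
have xE : x%:R = m%:R + 1 - y%:R - z%:R :> R by rewrite mE nE; ring.
rewrite /urn_flow /level_mass /= -(natr1 m) xE.
have m0 : 0 <= m%:R :> R by [].
have m3 : m%:R + 1 + 3 != 0 :> R by rewrite lt0r_neq0 //; lra.
have m2 : m%:R + 1 + 2 != 0 :> R by rewrite lt0r_neq0 //; lra.
have m1 : m%:R + 1 + 1 != 0 :> R by rewrite lt0r_neq0 //; lra.
have m30 : m%:R + 3 != 0 :> R by rewrite lt0r_neq0 //; lra.
have m20 : m%:R + 2 != 0 :> R by rewrite lt0r_neq0 //; lra.
have m10 : m%:R + 1 != 0 :> R by rewrite lt0r_neq0 //; lra.
case: (ltngtP m.+1 N) => [lt|lt|EN].
- rewrite /= mulr0n mul0r; field.
  by rewrite ?m3 ?m2 ?m1 ?m30 ?m20 ?m10.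
- rewrite /= mulr0n mul0r; lra.
- rewrite -EN -(natr1 m) /= mulr1n; field.
  by rewrite ?m3 ?m2 ?m1 ?m30 ?m20 ?m10.
Qed.

Lemma urn_flow_ge0 N n x : 0 <= urn_flow N n x.
Proof. by rewrite /urn_flow /level_mass; case: ifP. Qed.

Lemma urn_flow_le N n x : (x <= n)%N -> urn_flow N n x <= level_mass n.
Proof.
move=> xn; have lm : 0 <= level_mass n.
  by rewrite /level_mass divr_ge0 // mulr_ge0 ?addr_ge0.
rewrite /urn_flow; case: ifP => // _; rewrite -[leRHS]mulr1 ler_wpM2l //.
rewrite ler_pdivrMr ?ltr_wpDl // mul1r.
have : x%:R <= n%:R :> R by rewrite ler_nat.
lra.
Qed.

(** The energy of the flow is finite because the square of the mass of a
    vertex is of order n^-4 whereas a level has of order n^2 vertices. Comparing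
    the square with 24 / ((n+1) (n+2) (n+3) (n+4)) makes the sums over the three
    coordinates telescope one after the other. *)
Lemma cube_sum_level_mass N :
  cube_sum N (fun x y z => level_mass (x + y + z) ^+ 2) <= 4.
Proof.
pose q (s : nat) : R := s%:R + 1.
have q0 s : 0 < q s by rewrite /q ltr_wpDl.
have qS s : q s.+1 = q s + 1 by rewrite /q -natr1.
have base n : level_mass n ^+ 2 <= 24 / (q n * q n.+1 * q n.+2 * q n.+3).
  rewrite /level_mass !qS; have : 1 <= q n by rewrite /q lerDr.
  have -> : n%:R + 2 = q n + 1 :> R by rewrite /q; ring.
  rewrite -/(q n); move: (q n) => u u1; have u0 : 0 < u by lra.
  rewrite expr_div_n ler_pdivlMr; last by rewrite !mulr_gt0 //; lra.
  rewrite mulrAC ler_pdivrMr ?exprn_gt0 ?mulr_gt0 //; last lra.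
  have : 0 <= (u * (u + 1)) * (6 * (u * (u + 1)) - (u + 2) * (u + 3)).
    by apply: mulr_ge0; nra.
  lra.
have s1 s : \sum_(z < N) level_mass (s + z) ^+ 2 <= 8 / (q s * q s.+1 * q s.+2).
  pose G z := 8 / (q (s + z)%N * q (s + z).+1 * q (s + z).+2).
  have /le_trans -> : \sum_(z < N) level_mass (s + z) ^+ 2 <= G 0%N => //;
    last by rewrite /G addn0.
  apply: (@sum_le_telescope (fun z => level_mass (s + z) ^+ 2)) => z.
    by rewrite /G divr_ge0 // !mulr_ge0 // ltW.
  apply: (le_trans (base _)); rewrite /G addnS !qS le_eqVlt; apply/orP; left.
  have := q0 (s + z)%N; move: (q _) => u u0; apply/eqP; field.
  by rewrite !lt0r_neq0 //; lra.
have s2 s : \sum_(y < N) 8 / (q (s + y)%N * q (s + y).+1 * q (s + y).+2)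
    <= 4 / (q s * q s.+1).
  pose G z := 4 / (q (s + z)%N * q (s + z).+1).
  have /le_trans -> : \sum_(y < N) 8 / (q (s + y)%N * q (s + y).+1 * q (s + y).+2)
    <= G 0%N => //; last by rewrite /G addn0.
  apply: (@sum_le_telescope (fun y => 8 / (q (s + y)%N * q (s + y).+1 * q (s + y).+2))) => z.
    by rewrite /G divr_ge0 // !mulr_ge0 // ltW.
  rewrite /G addnS !qS le_eqVlt; apply/orP; left.
  have := q0 (s + z)%N; move: (q _) => u u0; apply/eqP; field.
  by rewrite !lt0r_neq0 //; lra.
have s3 : \sum_(x < N) 4 / (q x * q x.+1) <= 4 / q 0%N.
  apply: (@sum_le_telescope (fun x => 4 / (q x * q x.+1)) (fun x => 4 / q x)) => z.
    by rewrite divr_ge0 // ltW.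
  rewrite !qS le_eqVlt; apply/orP; left.
  have := q0 z; move: (q _) => u u0; apply/eqP; field.
  by rewrite !lt0r_neq0 //; lra.
have -> : 4 = 4 / q 0%N by rewrite /q add0r divr1.
apply: le_trans s3; rewrite /cube_sum; apply: ler_sum => x _.
apply: le_trans (s2 x); apply: ler_sum => y _; exact: s1.
Qed.

Lemma cube_sum_shiftx N F : (forall y z, F 0%N y z = 0) -> (forall y z, F N y z = 0) ->
  cube_sum N (fun x y z => F x.+1 y z) = cube_sum N F.
Proof.
move=> F0 FN; rewrite /cube_sum.
apply: (@sum_shift (fun x => \sum_(y < N) \sum_(z < N) F x y z)).
  by apply: big1 => y _; apply: big1.
by apply: big1 => y _; apply: big1.
Qed.

Lemma cube_sum_shifty N F : (forall x z, F x 0%N z = 0) -> (forall x z, F x N z = 0) ->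
  cube_sum N (fun x y z => F x y.+1 z) = cube_sum N F.
Proof.
move=> F0 FN; rewrite /cube_sum; apply: eq_bigr => x _.
by apply: (@sum_shift (fun y => \sum_(z < N) F x y z)); apply: big1.
Qed.

Lemma cube_sum_shiftz N F : (forall x y, F x y 0%N = 0) -> (forall x y, F x y N = 0) ->
  cube_sum N (fun x y z => F x y z.+1) = cube_sum N F.
Proof.
move=> F0 FN; rewrite /cube_sum; apply: eq_bigr => x _; apply: eq_bigr => y _.
exact: (@sum_shift (fun z => F x y z)).
Qed.

Lemma urn_flow_out N n x : (N <= n)%N -> urn_flow N n x = 0.
Proof. by rewrite /urn_flow ltnNge => ->. Qed.

(** Pairing the gradient of b with the flow leaves the value of b at the source
    minus its average over the level where the flow is absorbed. *)
Lemma urn_flow_parts N b : (0 < N)%N ->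
  let flow x y z v := urn_flow N (x + y + z) v in
    cube_sum N.+1 (fun x y z => flow x y z x * (b x y z - b x.+1 y z))
  + cube_sum N.+1 (fun x y z => flow x y z y * (b x y z - b x y.+1 z))
  + cube_sum N.+1 (fun x y z => flow x y z z * (b x y z - b x y z.+1))
  = b 0%N 0%N 0%N
    - cube_sum N.+1 (fun x y z => (x + y + z == N)%N%:R * level_mass N * b x y z).
Proof.
move=> N0 flow.
pose inflow x y z v := urn_flow N (x + y + z).-1 v.-1 *+ (0 < v)%N.
have ex : cube_sum N.+1 (fun x y z => flow x y z x * b x.+1 y z) =
    cube_sum N.+1 (fun x y z => inflow x y z x * b x y z).
  rewrite -(@cube_sum_shiftx _ (fun x y z => inflow x y z x * b x y z)).
  - by apply: eq_cube_sum => x y z *; rewrite /inflow /= mulr1n.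
  - by move=> y z; rewrite /inflow ltnn mulr0n mul0r.
  - move=> y z; rewrite /inflow urn_flow_out ?mul0rn ?mul0r //.
    lia.
have ey : cube_sum N.+1 (fun x y z => flow x y z y * b x y.+1 z) =
    cube_sum N.+1 (fun x y z => inflow x y z y * b x y z).
  rewrite -(@cube_sum_shifty _ (fun x y z => inflow x y z y * b x y z)).
  - by apply: eq_cube_sum => x y z *; rewrite /inflow ?(addnS, addSn) /= mulr1n.
  - by move=> x z; rewrite /inflow ltnn mulr0n mul0r.
  - move=> x z; rewrite /inflow urn_flow_out ?mul0rn ?mul0r //.
    lia.
have ez : cube_sum N.+1 (fun x y z => flow x y z z * b x y z.+1) =
    cube_sum N.+1 (fun x y z => inflow x y z z * b x y z).
  rewrite -(@cube_sum_shiftz _ (fun x y z => inflow x y z z * b x y z)).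
  - by apply: eq_cube_sum => x y z *; rewrite /inflow ?(addnS, addSn) /= mulr1n.
  - by move=> x y; rewrite /inflow ltnn mulr0n mul0r.
  - move=> x y; rewrite /inflow urn_flow_out ?mul0rn ?mul0r //.
    lia.
have split_diff (c : nat -> nat -> nat -> R) b' :
    cube_sum N.+1 (fun x y z => c x y z * (b x y z - b' x y z)) =
    cube_sum N.+1 (fun x y z => c x y z * b x y z)
    - cube_sum N.+1 (fun x y z => c x y z * b' x y z).
  by rewrite -cube_sumB; apply: eq_cube_sum => x y z *; rewrite mulrBr.
rewrite (split_diff (fun x y z => flow x y z x) (fun x y z => b x.+1 y z)) ex.
rewrite (split_diff (fun x y z => flow x y z y) (fun x y z => b x y.+1 z)) ey.
rewrite (split_diff (fun x y z => flow x y z z) (fun x y z => b x y z.+1)) ez.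
rewrite -!cube_sumB -!cube_sumD.
have -> : b 0%N 0%N 0%N = cube_sum N.+1 (fun x y z => (x + y + z == 0)%N%:R * b x y z).
  rewrite /cube_sum !big_ord_recl /= big1 ?addr0; last first.
    move=> z _; rewrite /= mulr0n mul0r //.
  rewrite big1 ?addr0; last by move=> y _; apply: big1 => z _; rewrite /= mul0r.
  rewrite big1 ?addr0 ?eqxx ?mul1r // => x _.
  by apply: big1 => y _; apply: big1 => z _; rewrite /= mul0r.
rewrite -cube_sumB; apply: eq_cube_sum => x y z _ _ _.
rewrite -mulrBl -!mulrBl -!mulrDl; congr (_ * _).
rewrite -urn_flow_divergence // /flow /inflow; ring.
Qed.

(** Transience of the simple random walk on Z^3 in the form of an inequality:
    the gradient part is controlled by the energy of the flow, and the average
    over level N tends to 0 for square-summable b. The bound does not involve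
    M, which is what makes it usable below. *)
Lemma transient_point_bound b (Dx Dy Dz M : R) :
  (forall N, cube_sum N (fun x y z => (b x y z - b x.+1 y z) ^+ 2) <= Dx) ->
  (forall N, cube_sum N (fun x y z => (b x y z - b x y.+1 z) ^+ 2) <= Dy) ->
  (forall N, cube_sum N (fun x y z => (b x y z - b x y z.+1) ^+ 2) <= Dz) ->
  (forall N, cube_sum N (fun x y z => b x y z ^+ 2) <= M) ->
  b 0%N 0%N 0%N ^+ 2 <= 16 * (Dx + Dy + Dz).
Proof.
move=> hx hy hz hM.
have bound N : (0 < N)%N ->
    b 0%N 0%N 0%N ^+ 2 <= 16 * (Dx + Dy + Dz) + 16 * M / N%:R.
  move=> N0; have := urn_flow_parts b N0 => /=.
  set A := cube_sum _ _; set B := cube_sum _ _; set C := cube_sum _ _.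
  set E := cube_sum _ _ => eq.
  have flow2 (k : nat -> nat -> nat -> nat) : (forall x y z, k x y z <= x + y + z)%N ->
      cube_sum N.+1 (fun x y z => urn_flow N (x + y + z) (k x y z) ^+ 2) <= 4.
    move=> kle; apply: le_trans (cube_sum_level_mass N.+1).
    apply: le_cube_sum => x y z; rewrite ler_sqr ?nnegrE ?urn_flow_ge0 //.
      exact: urn_flow_le.
    by rewrite (le_trans (urn_flow_ge0 N (x + y + z) (k x y z))) // urn_flow_le.
  have cs F G K L : cube_sum N.+1 (fun x y z => F x y z ^+ 2) <= K ->
      cube_sum N.+1 (fun x y z => G x y z ^+ 2) <= L ->
      cube_sum N.+1 (fun x y z => F x y z * G x y z) ^+ 2 <= K * L.
    move=> hF hG; apply: (le_trans (cube_sum_cauchy_schwarz _ _ _)).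
    by apply: ler_pM => //; rewrite cube_sumE; apply: sumr_ge0 => *; exact: sqr_ge0.
  have hA : A ^+ 2 <= 4 * Dx.
    by apply: cs (hx _); apply: (flow2 (fun x _ _ => x)) => x y z; lia.
  have hB : B ^+ 2 <= 4 * Dy.
    by apply: cs (hy _); apply: (flow2 (fun _ y _ => y)) => x y z; lia.
  have hC : C ^+ 2 <= 4 * Dz.
    by apply: cs (hz _); apply: (flow2 (fun _ _ z => z)) => x y z; lia.
  have hE : E ^+ 2 <= 4 / N%:R * M.
    apply: cs (hM _).
    have lm : (level_mass N) ^+ 2 * N.+1%:R ^+ 3 <= 4 / N%:R.
      rewrite /level_mass -(natr1 N); have : 1 <= N%:R :> R by rewrite ler1n.
      move: (N%:R) => u u1; rewrite ler_pdivlMr; last lra.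
      rewrite expr_div_n mulrAC -mulrA mulrAC ler_pdivrMr; last first.
        by rewrite exprn_gt0 // mulr_gt0 //; lra.
      have : 0 <= (u + 1) ^+ 2 * ((u + 2) ^+ 2 - (u + 1) * u).
        by rewrite mulr_ge0 ?sqr_ge0 //; nra.
      lra.
    apply: le_trans lm.
    apply: (@le_trans _ _ (cube_sum N.+1 (fun _ _ _ => level_mass N ^+ 2))).
      apply: le_cube_sum => x y z; rewrite exprMn ler_piMl ?sqr_ge0 //.
      by case: eqP => _; rewrite ?expr1n ?expr0n.
    rewrite /cube_sum !sumr_const !card_ord le_eqVlt; apply/orP; left; apply/eqP.
    ring.
  have -> : b 0%N 0%N 0%N = A + B + C + E by rewrite eq subrK.
  have := sqr_ge0 (A - B); have := sqr_ge0 (A - C); have := sqr_ge0 (A - E).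
  have := sqr_ge0 (B - C); have := sqr_ge0 (B - E); have := sqr_ge0 (C - E).
  have : 16 * M / N%:R = 4 * (4 / N%:R * M) by ring.
  nra.
have M0 : 0 <= M.
  apply: le_trans (hM 0%N); rewrite cube_sumE; apply: sumr_ge0 => *; exact: sqr_ge0.
apply/ler_addgt0Pr => e e0.
(* N is chosen so that the boundary term is at most e. *)
pose N := (Num.truncn (16 * M / e)).+1.
have := bound N isT; move/le_trans; apply; rewrite lerD2l ler_pdivrMr ?ltr0n //.
have /ltW := truncnS_gt (16 * M / e).
by rewrite ler_pdivrMr // [e * _]mulrC.
Qed.
End Transience.

(** * One-step estimates for dissipative recursions *)

Section PreHilbert.
Variables (R : realFieldType) (V : lmodType R) (dot : V -> V -> R).
Hypothesis dotC : forall f g, dot f g = dot g f.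
Hypothesis dotDl : forall f g h, dot (f + g) h = dot f h + dot g h.
Hypothesis dotZl : forall a f g, dot (a *: f) g = a * dot f g.
Hypothesis dot_ge0 : forall f, 0 <= dot f f.

Lemma dotDr f g h : dot h (f + g) = dot h f + dot h g.
Proof. by rewrite dotC dotDl !(dotC h). Qed.

Lemma dotZr a f g : dot g (a *: f) = a * dot g f.
Proof. by rewrite dotC dotZl (dotC g). Qed.

Lemma dotNl f g : dot (- f) g = - dot f g.
Proof. by rewrite -scaleN1r dotZl mulN1r. Qed.

Lemma dotNr f g : dot g (- f) = - dot g f.
Proof. by rewrite dotC dotNl dotC. Qed.

Lemma dot0l g : dot 0 g = 0.
Proof. by rewrite -(scale0r 0) dotZl mul0r. Qed.

Lemma dot_suml (I : finType) (P : pred I) (F : I -> V) g :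
  dot (\sum_(i | P i) F i) g = \sum_(i | P i) dot (F i) g.
Proof. exact: (big_morph (dot^~ g) (fun f h => dotDl f h g) (dot0l g)). Qed.

Lemma dot_sumr (I : finType) (P : pred I) (F : I -> V) g :
  dot g (\sum_(i | P i) F i) = \sum_(i | P i) dot g (F i).
Proof. by rewrite dotC dot_suml; apply: eq_bigr => i _; exact: dotC. Qed.

Let dotE := (dotDl, dotDr, dotNl, dotNr, dotZl, dotZr).

Lemma dot_cauchy_schwarz f g : dot f g ^+ 2 <= dot f f * dot g g.
Proof.
have := dot_ge0 (dot g g *: f - dot f g *: g); rewrite !dotE (dotC g f) => h.
have [g0|gN0] := eqVneq (dot g g) 0; last first.
  have g1 : 0 < dot g g by rewrite lt0r gN0 dot_ge0.
  rewrite -(ler_pM2l g1); lra.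
rewrite g0 mulr0.
have h1 (a : R) : 0 <= dot f f + 2 * a * dot f g.
  have := dot_ge0 (f + a *: g); rewrite !dotE (dotC g f) g0; lra.
have [->|nz] := eqVneq (dot f g) 0; first by rewrite expr0n.
(* This multiple of g makes the quadratic expression equal to - 1. *)
have := h1 (- (dot f f + 1) / (2 * dot f g)).
have -> : 2 * (- (dot f f + 1) / (2 * dot f g)) * dot f g = - (dot f f + 1) by field.
lra.
Qed.

Lemma bessel_le (I : finType) (e : I -> V) f :
  (forall i j, i != j -> dot (e i) (e j) = 0) -> (forall i, dot (e i) (e i) <= 1) ->
  \sum_i dot (e i) f ^+ 2 <= dot f f.
Proof.
move=> orth unit; pose g := \sum_i dot (e i) f *: e i.
have fg : dot f g = \sum_i dot (e i) f ^+ 2.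
  by rewrite /g dot_sumr; apply: eq_bigr => i _; rewrite dotZr expr2 (dotC f).
have gg : dot g g <= \sum_i dot (e i) f ^+ 2.
  rewrite {1}/g dot_suml; apply: ler_sum => i _.
  rewrite dotZl /g dot_sumr (bigD1 i) //= big1 ?addr0 => [|j ji].
    by rewrite dotZr mulrA -expr2 ler_piMr ?sqr_ge0.
  by rewrite dotZr orth 1?eq_sym // mulr0.
have := dot_ge0 (f - g); rewrite !dotE (dotC g f) fg; lra.
Qed.

Lemma dot_parallelogram f g : 2 * dot f g <= dot f f + dot g g.
Proof. by have := dot_ge0 (f - g); rewrite !dotE (dotC g f); lra. Qed.

Section Recursion.
Variables (L U : V -> V) (th eps : R) (f phi : V).
Hypotheses (th0 : 0 < th) (eps0 : 0 < eps).
Let f' := f + th *: L f + phi.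

(** With n = (1 - th + th eps U) f one has f' - n = phi + th A f, hence
    |phi|^2 + 2 th <phi, A f> = |f' - n|^2 - th^2 |A f|^2. The cross term
    <f', n> is estimated by Cauchy-Schwarz for the quadratic form of
    1 - th + th eps U, nonnegative for the th considered; what remains besides
    the increment of the potential is th^2 (|(1 - eps U) f|^2 - |A f|^2), and
    |(1 - eps U) f| >= |f| because U <= 0. *)
Lemma isometry_step_lower (A : V -> V) :
  L f = A f - f + eps *: U f ->
  dot (A f) (A f) <= dot f f ->
  (forall g h, U (g - h) = U g - U h) ->
  (forall g h, dot g (U h) = dot (U g) h) ->
  (forall g, dot g (U g) <= 0) -> (forall g, - (2 * dot g g) <= dot g (U g)) ->
  th * (1 + 2 * eps) <= 1 ->
  th * (dot f' f' - eps * dot f' (U f')) - th * (dot f f - eps * dot f (U f))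
    <= dot phi phi + 2 * th * dot phi (A f).
Proof.
move=> LE Aiso UB Usym U0 U2 th1.
pose n := f - th *: f + (th * eps) *: U f.
have phiE : f' - n = phi + th *: A f.
  apply/eqP; rewrite subr_eq /f' /n LE !scalerDr scalerN scalerA !addrA.
  by rewrite [eqbLHS](ACl (5*2*1*3*4)).
clearbody f'.
have e1 : dot (f' - n) (f' - n) =
   dot phi phi + 2 * th * dot phi (A f) + th ^+ 2 * dot (A f) (A f).
  by rewrite phiE !dotE (dotC (A f)); ring.
(* 1 - th + th eps U is nonnegative because U >= - 2 and th (1 + 2 eps) <= 1. *)
have psd : 0 <= dot (f' - f) (f' - f) * (1 - th) + th * eps * dot (f' - f) (U (f' - f)).
  have := U2 (f' - f); have := dot_ge0 (f' - f).
  have : 0 < th * eps by rewrite mulr_gt0.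
  move: (dot (f' - f) (f' - f)) (dot (f' - f) (U (f' - f))) => a u te a0 ua.
  have : 0 <= th * eps * (u + 2 * a) by rewrite mulr_ge0 ?(ltW te) //; lra.
  have : 0 <= a * (1 - th * (1 + 2 * eps)) by rewrite mulr_ge0 //; lra.
  lra.
move: psd e1; rewrite UB /n !dotE (dotC f f').
have := Usym f' f; rewrite (dotC (U f')) => ->; rewrite (dotC (U f) f).
have := Usym f f'; rewrite (dotC (U f)) => e2.
have : th ^+ 2 * dot (A f) (A f) <= th ^+ 2 * dot f f.
  by rewrite ler_wpM2l // sqr_ge0.
have : 0 <= th ^+ 2 * (eps ^+ 2 * dot (U f) (U f)).
  by apply: mulr_ge0; [exact: sqr_ge0 | apply: mulr_ge0; [exact: sqr_ge0|]].
have : 0 <= th ^+ 2 * eps * - dot f (U f).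
  apply: mulr_ge0; last by rewrite oppr_ge0.
  by apply: mulr_ge0; [exact: sqr_ge0|exact: ltW].
move: e2; nra.
Qed.

(** Expand |f'|^2 - |f|^2 = |f' - f|^2 + 2 <f' - f, f>. *)
Lemma dissipative_step_lower (kappa : R) :
  dot f (L f) <= 0 -> dot (f' - f) (f' - f) <= kappa ->
  dot f' f' - dot f f - kappa <= 2 * dot phi f.
Proof.
move=> L0; have <- : th *: L f + phi = f' - f by rewrite /f' -[f + _ + _]addrA addrAC subrr add0r.
rewrite /f' !dotE !(dotC _ f) (dotC phi (L f)) => h.
have : 0 <= th * - dot f (L f) by rewrite mulr_ge0 ?(ltW th0) // oppr_ge0.
lra.
Qed.

Lemma young_of_sq (x K W t : R) : 0 < t -> 0 <= K -> 0 <= W -> x ^+ 2 <= K * W ->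
  2 * x <= t * W + K / t.
Proof.
move=> t0 K0 W0 xKW; set y := K / t.
have KE : K = y * t by rewrite /y divfK // gt_eqF.
have y0 : 0 <= y by rewrite /y divr_ge0 // ltW.
have tW : 0 <= t * W by rewrite mulr_ge0 // ltW.
rewrite leNgt; apply/negP => lt; rewrite KE in xKW.
have := sqr_ge0 (t * W - y); nra.
Qed.

(** With W = - <f, U f>, the increment of |f|^2 is at most
    kappa - 2 th eps W + 2 <phi, f>. Young's inequality bounds 2 <phi, f> and
    2 <phi', f> by th eps W + K / (th eps) each, so that W cancels in the sum. *)
Lemma dissipative_step_upper (kappa K : R) (phi' : V) :
  dot f (L f) <= eps * dot f (U f) -> dot (f' - f) (f' - f) <= kappa ->
  0 <= K -> dot f (U f) <= 0 ->
  dot phi f ^+ 2 <= K * - dot f (U f) -> dot phi' f ^+ 2 <= K * - dot f (U f) ->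
  2 * dot phi' f <= kappa + 2 * (K / (th * eps)) - (dot f' f' - dot f f).
Proof.
move=> L0 + K0 W0 h1 h2.
have <- : th *: L f + phi = f' - f by rewrite /f' -[f + _ + _]addrA addrAC subrr add0r.
rewrite /f' !dotE !(dotC _ f) (dotC phi (L f)) => h.
have te : 0 < th * eps by rewrite mulr_gt0.
have nW : 0 <= - dot f (U f) by rewrite oppr_ge0.
have := young_of_sq te K0 nW h1; have := young_of_sq te K0 nW h2.
rewrite (dotC phi) (dotC phi').
have : th * dot f (L f) <= th * (eps * dot f (U f)) by rewrite ler_wpM2l // ltW.
lra.
Qed.

End Recursion.
End PreHilbert.

(** * Moves, rates and local functions *)

Section Moves.
Variables (R : realType) (d : nat).
Implicit Types (om : env d) (z : state d) (a : arrow d).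

(** In (oa, (b1, b2)) the environment is swapped if b2, then shifted along the
    arrow given by oa, or along the hand arrow if oa is None, then swapped if
    b1. Both generators are combinations of these moves, and treating them
    together leaves only the rates of the hand moves to distinguish M1 from M2. *)
Definition jump := (option (arrow d) * (bool * bool))%type.

Definition swap_if (b : bool) om : env d := if b then env_swap om else om.

Definition env_move (i : jump) om : env d :=
  let om' := swap_if i.2.2 om in
  swap_if i.2.1 (if i.1 is Some a then env_step a om' else env_step_hand om').

Definition move_arrow (i : jump) om : arrow d :=
  if i.1 is Some a then a else swap_if i.2.2 om None.

Definition st_move (i : jump) z : state d :=
  (env_move i z.1, z.2 + arrow_vec (move_arrow i z.1)).

Definition hand_rate (m : model) (i : jump) : R :=
  if i.1 is Some _ then 0 else
  match m with M1 => (i.2 == (true, false))%:R | M2 => 4^-1 end.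

Definition free_rate (i : jump) : R :=
  if i.1 is Some _ then ((2 * d)%:R * 4)^-1 else 0.

Definition jump_rate m (eps : R) i := hand_rate m i + eps * free_rate i.

Lemma sum_option (T : finType) (F : option T -> R) :
  \sum_o F o = F None + \sum_a F (Some a).
Proof.
rewrite (bigD1 None) //= (reindex_omap Some id) => [|[a|] //].
by congr (_ + _); apply: eq_bigl => a; rewrite /= eqxx.
Qed.

Lemma sum_move (F : jump -> R) :
  \sum_i F i = \sum_(b : bool * bool) F (None, b) + \sum_a \sum_(b : bool * bool) F (Some a, b).
Proof.
transitivity (\sum_(o : option (arrow d)) \sum_(b : bool * bool) F (o, b)).
  by rewrite pair_bigA; apply: eq_bigr => -[].
exact: sum_option.
Qed.

Lemma sum_bool2 (F : bool * bool -> R) : \sum_b F b =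
  F (true, true) + F (true, false) + F (false, true) + F (false, false).
Proof.
transitivity (\sum_(b1 : bool) \sum_(b2 : bool) F (b1, b2)).
  by rewrite pair_bigA; apply: eq_bigr => -[].
by rewrite big_bool !big_bool /= addrA.
Qed.

Lemma generatorE m eps (F : state d -> R) z :
  generator m eps F z = \sum_i jump_rate m eps i * (F (st_move i z) - F z).
Proof.
rewrite sum_move sum_bool2; under eq_bigr do rewrite sum_bool2.
rewrite /jump_rate /hand_rate /free_rate /=.
have -> : \sum_(a : arrow d)
   ((0 + eps / ((2 * d)%:R * 4)) * (F (st_move (Some a, (true, true)) z) - F z) +
    (0 + eps / ((2 * d)%:R * 4)) * (F (st_move (Some a, (true, false)) z) - F z) +
    (0 + eps / ((2 * d)%:R * 4)) * (F (st_move (Some a, (false, true)) z) - F z) +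
    (0 + eps / ((2 * d)%:R * 4)) * (F (st_move (Some a, (false, false)) z) - F z))
  = eps * U_op (@st_swap d) (@st_step d) F z.
  rewrite /U_op mulrA mulr_sumr; apply: eq_bigr => a _; rewrite /Tt_op.
  rewrite invfM; move: ((2 * d)%:R^-1) => v.
  by rewrite /st_move /env_move /st_swap /st_step /move_arrow /swap_if /=; field.
by case: m; rewrite /= /M1_op /M2_op; congr (_ + _);
  rewrite /T_op /Tt_op /st_move /env_move /st_swap /st_step_hand /move_arrow /swap_if /=; field.
Qed.

Lemma hand_rate_ge0 m i : 0 <= hand_rate m i.
Proof. by rewrite /hand_rate; case: i => [[a|] b] //; case: m. Qed.

Lemma free_rate_ge0 i : 0 <= free_rate i.
Proof. by rewrite /free_rate; case: i => [[a|] b] //=. Qed.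

Lemma rate_ge0 m eps i : 0 <= eps -> 0 <= jump_rate m eps i.
Proof.
by move=> e0; rewrite addr_ge0 ?hand_rate_ge0 // mulr_ge0 ?free_rate_ge0.
Qed.

Lemma hand_rate_sum m : \sum_i hand_rate m i = 1.
Proof.
rewrite sum_move addrC big1 ?add0r => [|a _]; last exact: big1.
by rewrite sum_bool2 /hand_rate; case: m => /=; field.
Qed.

Lemma free_rate_sum : (0 < d)%N -> \sum_i free_rate i = 1.
Proof.
move=> d0; rewrite sum_move big1 ?add0r => [|b _] //.
under eq_bigr do rewrite sum_bool2 /free_rate /=.
rewrite sumr_const card_prod card_ord card_bool -mulr_natr mulnC natrM.
have : d%:R != 0 :> R by rewrite pnatr_eq0 -lt0n.
by move=> d1; field.
Qed.

Lemma rate_sum m eps : (0 < d)%N -> \sum_i jump_rate m eps i = 1 + eps.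
Proof.
by move=> d0; rewrite big_split -mulr_sumr /= hand_rate_sum free_rate_sum // mulr1.
Qed.

Definition flip_arrow a : arrow d := (a.1, ~~ a.2).

Lemma arrow_vec_flip a : arrow_vec (flip_arrow a) = - arrow_vec a.
Proof.
by rewrite /arrow_vec -scaleNr; case: a => i [] /=; rewrite ?expr1 ?expr0 ?opprK.
Qed.

Definition reverse_move (i : jump) : jump :=
  (omap flip_arrow i.1, (i.2.2, i.2.1)).

Lemma reverse_moveK : involutive reverse_move.
Proof. by move=> [[[i []]|] [b1 b2]]. Qed.

Lemma free_rate_reverse i : free_rate (reverse_move i) = free_rate i.
Proof. by case: i => [[]]. Qed.

Lemma env_swapK : involutive (@env_swap d).
Proof.
move=> om; apply/funext => -[y|] /=; last by rewrite eqxx.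
by case: eqP => // ->.
Qed.

Lemma swap_ifK b : involutive (swap_if b).
Proof. by move=> om; case: b => //=; exact: env_swapK. Qed.

Lemma env_step_flip a om : env_step (flip_arrow a) (env_step a om) = om.
Proof.
by apply/funext => -[y|] //=; rewrite arrow_vec_flip subrK.
Qed.

(** The free moves come in pairs of inverse moves of equal rates, which makes U
    symmetric. *)
Lemma env_move_reverse i om : free_rate i != 0 ->
  env_move (reverse_move i) (env_move i om) = om.
Proof.
case: i => [[a|] [b1 b2]]; rewrite /free_rate /env_move /= ?eqxx // => _.
by rewrite swap_ifK env_step_flip swap_ifK.
Qed.

Definition agree (s : seq (site d)) om om' := forall x, x \in s -> om x = om' x.

Definition local (f : env d -> R) :=
  exists s, forall om om', agree s om om' -> f om = f om'.

Definition local_map (A : env d -> env d) := forall s, exists s',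
  forall om om', agree s' om om' -> agree s (A om) (A om').

Lemma agree_sub s s' om om' : {subset s <= s'} -> agree s' om om' -> agree s om om'.
Proof. by move=> ss h x /ss /h. Qed.

Lemma agree_catl s s' om om' : agree (s ++ s') om om' -> agree s om om'.
Proof. by apply: agree_sub => x; rewrite mem_cat => ->. Qed.

Lemma agree_catr s s' om om' : agree (s ++ s') om om' -> agree s' om om'.
Proof. by apply: agree_sub => x; rewrite mem_cat => ->; rewrite orbT. Qed.

Lemma local_cst c : local (fun=> c).
Proof. by exists [::]. Qed.

Lemma local_at (x : site d) (h : arrow d -> R) : local (fun om => h (om x)).
Proof. by exists [:: x] => om om' -> //; rewrite inE. Qed.

Lemma local_op2 (op : R -> R -> R) f g : local f -> local g ->
  local (fun om => op (f om) (g om)).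
Proof.
move=> [s fs] [s' gs]; exists (s ++ s') => om om' ag.
by rewrite (fs _ _ (agree_catl ag)) (gs _ _ (agree_catr ag)).
Qed.

Lemma localD f g : local f -> local g -> local (fun om => f om + g om).
Proof. exact: (@local_op2 (fun x y => x + y)). Qed.

Lemma localB f g : local f -> local g -> local (fun om => f om - g om).
Proof. exact: (@local_op2 (fun x y => x - y)). Qed.

Lemma localM f g : local f -> local g -> local (fun om => f om * g om).
Proof. exact: (@local_op2 (fun x y => x * y)). Qed.

Lemma localZ c f : local f -> local (fun om => c * f om).
Proof. by apply: localM; exact: local_cst. Qed.

Lemma local_sum (I : Type) (r : seq I) (P : pred I) (F : I -> env d -> R) :
  (forall i, P i -> local (F i)) -> local (fun om => \sum_(i <- r | P i) F i om).
Proof.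
move=> FL; elim: r => [|i r IH].
  rewrite (_ : (fun _ => _) = fun=> 0); first exact: local_cst.
  by apply/funext => om; rewrite big_nil.
case Pi : (P i); last first.
  rewrite (_ : (fun _ => _) = fun om => \sum_(j <- r | P j) F j om) //.
  by apply/funext => om; rewrite big_cons Pi.
rewrite (_ : (fun _ => _) = fun om => F i om + \sum_(j <- r | P j) F j om).
  exact: localD (FL _ Pi) IH.
by apply/funext => om; rewrite big_cons Pi.
Qed.

Lemma local_comp f A : local f -> local_map A -> local (f \o A).
Proof. by move=> [s fs] /(_ s)[s' As]; exists s' => om om' /As /fs. Qed.

Lemma local_map_comp A B : local_map A -> local_map B -> local_map (A \o B).
Proof. by move=> hA hB s; have [s1 h1] := hA s; have [s2 h2] := hB s1; exists s2 => om om' /h2 /h1. Qed.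

Lemma local_map_coord A :
  (forall x, exists s, forall om om', agree s om om' -> A om x = A om' x) -> local_map A.
Proof.
move=> hA; elim=> [|x s [s' IH]]; first by exists [::].
have [t ht] := hA x; exists (t ++ s') => om om' ag y; rewrite inE => /predU1P[->|ys].
  exact: ht (agree_catl ag).
exact: IH (agree_catr ag) _ ys.
Qed.

Lemma local_map_reindex (A : env d -> env d) (r : site d -> site d) :
  (forall om x, A om x = om (r x)) -> local_map A.
Proof.
move=> Ar; apply: local_map_coord => x; exists [:: r x] => om om' ag.
by rewrite !Ar ag ?inE.
Qed.

Definition swap_site (x : site d) : site d :=
  match x with None => Some 0 | Some y => if y == 0 then None else Some y end.

Definition shift_site (v : 'rV[int]_d) (x : site d) : site d :=
  if x is Some y then Some (y + v) else None.

Lemma env_swapE om x : env_swap om x = om (swap_site x).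
Proof. by case: x => [y|] //=; case: eqP. Qed.

Lemma env_shiftE v om x : env_shift v om x = om (shift_site v x).
Proof. by case: x. Qed.

Lemma swap_siteK : involutive swap_site.
Proof. by move=> [y|] /=; rewrite ?eqxx //; case: eqP => [->//|/eqP/negPf h] /=; rewrite h. Qed.

Lemma shift_siteK v : cancel (shift_site v) (shift_site (- v)).
Proof. by move=> [y|] //=; rewrite addrK. Qed.

Lemma local_map_swap_if b : local_map (swap_if b).
Proof.
case: b => /=; last by move=> s; exists s.
exact: local_map_reindex env_swapE.
Qed.

Lemma local_map_step a : local_map (env_step a).
Proof. exact: local_map_reindex (env_shiftE _). Qed.

(** Along the hand arrow the arrow read at a site depends on the hand, but there
    are only 2 d possibilities for the site read. *)
Lemma local_map_step_hand : local_map (@env_step_hand d).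
Proof.
apply: local_map_coord => -[y|]; last first.
  by exists [:: None] => om om' ag; rewrite /= ag ?inE.
exists (None :: [seq Some (y + arrow_vec a) | a <- enum {: arrow d}]) => om om' ag.
rewrite /env_step_hand /= (ag None) ?mem_head // ag // inE.
by rewrite map_f ?orbT // mem_enum.
Qed.

Lemma local_env_move i : local_map (env_move i).
Proof.
case: i => [oa [b1 b2]]; rewrite /env_move /=.
apply: (@local_map_comp (swap_if b1) _ (@local_map_swap_if b1)).
case: oa => [a|].
  exact: (local_map_comp (@local_map_step a) (@local_map_swap_if b2)).
exact: (local_map_comp local_map_step_hand (@local_map_swap_if b2)).
Qed.

Lemma local_move_arrow i (h : arrow d -> R) : local (fun om => h (move_arrow i om)).
Proof.
case: i => [[a|] [b1 b2]]; rewrite /move_arrow /=; first exact: local_cst.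
apply: (@local_comp (fun om => h (om None)) (swap_if b2)); last exact: local_map_swap_if.
exact: local_at.
Qed.
End Moves.

(** * The vector space of local functions *)

Section LocalFunctions.
Variables (R : realType) (d : nat).

(** Local functions are bundled into a vector space so that the estimates on
    quadratic forms apply to them without side conditions. *)
Definition is_local : pred (env d -> R) := fun f => `[< local f >].

Lemma is_local_submod : submod_closed is_local.
Proof.
split; first by apply/asboolP; exact: local_cst.
move=> a f g /asboolP fL /asboolP gL; apply/asboolP.
exact: (localD (localZ a fL) gL).
Qed.

HB.instance Definition _ := GRing.isSubmodClosed.Build R (env d -> R) is_local
  is_local_submod.

Record locfun := LocFun { lval :> env d -> R; lvalP : lval \in is_local }.

HB.instance Definition _ := [isSub for lval].
HB.instance Definition _ := [Choice of locfun by <:].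
HB.instance Definition _ := [SubChoice_isSubLmodule of locfun by <:].

Lemma locfun_local (f : locfun) : local f.
Proof. exact/asboolP/(lvalP f). Qed.

Definition to_locfun f (fL : local f) : locfun := LocFun (introT (asboolP _) fL).

Lemma locfun_ext (f g : locfun) : (forall om, f om = g om) -> f = g.
Proof. by move=> fg; apply/val_inj/funext. Qed.

Lemma locfunD (f g : locfun) om : (f + g) om = f om + g om.
Proof. by []. Qed.
Lemma locfunN (f : locfun) om : (- f) om = - f om.
Proof. by []. Qed.
Lemma locfunZ a (f : locfun) om : (a *: f) om = a * f om.
Proof. by []. Qed.
Lemma locfun0 om : (0 : locfun) om = 0.
Proof. by []. Qed.
Lemma locfun_sum (I : Type) (r : seq I) (P : pred I) (F : I -> locfun) om :
  (\sum_(i <- r | P i) F i) om = \sum_(i <- r | P i) F i om.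
Proof. by elim/big_rec2: _ => // i x y _ <-. Qed.

End LocalFunctions.

HB.lock Definition lcomp (R : realType) d A (AL : local_map A) (f : locfun R d) : locfun R d :=
  to_locfun (local_comp (locfun_local f) AL).

Lemma lcompE (R : realType) d A (AL : local_map A) (f : locfun R d) om :
  lcomp AL f om = f (A om).
Proof. by rewrite unlock. Qed.

Definition pull (R : realType) d (i : jump d) : locfun R d -> locfun R d :=
  lcomp (@local_env_move d i).

Lemma pullE (R : realType) d (i : jump d) (f : locfun R d) om :
  pull i f om = f (env_move i om).
Proof. exact: lcompE. Qed.

Definition locfunE := (pullE, lcompE, locfun_sum, locfunD, locfunN, locfunZ, locfun0).

(** * The product measure and its invariance *)

Definition cyl_indic (R : realType) d (s : seq (site d)) (t : seq (arrow d)) (om : env d) : R :=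
  (map om s == t)%:R.

(** The expectation under pi_p of functions of finitely many arrows is
    determined by linearity and by the cylinder probabilities. *)
Record pi_expectation (R : realType) d (p : 'I_d -> R) (Ex : (env d -> R) -> R) : Prop := {
  ex_linear : forall a f g, local f -> local g ->
    Ex (fun om => a * f om + g om) = a * Ex f + Ex g;
  ex_ge0 : forall f, local f -> (forall om, 0 <= f om) -> 0 <= Ex f;
  ex_cylinder : forall s a, uniq s ->
    Ex (cyl_indic R s (map a s)) = \prod_(x <- s) mu p (a x) }.

Section Expectation.
Variables (R : realType) (d : nat) (p : 'I_d -> R) (Ex : (env d -> R) -> R).
Hypothesis ExP : pi_expectation p Ex.
Hypothesis d_gt0 : (0 < d)%N.
Implicit Types (f g : env d -> R).

Lemma exZ a f : local f -> Ex (fun om => a * f om) = a * Ex f.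
Proof.
move=> fL.
have e0 : Ex (fun=> 0) = 0.
  have := ex_linear ExP 1 (local_cst d 0) (local_cst d 0).
  by rewrite mulr0 addr0; lra.
by rewrite -[RHS]addr0 -e0 -(ex_linear ExP) ?(funext (fun=> addr0 _)) //; exact: local_cst.
Qed.

Lemma exD f g : local f -> local g -> Ex (fun om => f om + g om) = Ex f + Ex g.
Proof.
move=> fL gL; rewrite -[Ex f]mul1r -(ex_linear ExP) //.
by congr Ex; apply/funext => om; rewrite mul1r.
Qed.

Lemma ex0 : Ex (fun=> 0) = 0.
Proof.
rewrite -[RHS](mul0r (Ex (fun=> 0))) -exZ; last exact: local_cst.
by congr Ex; apply/funext => om; rewrite mul0r.
Qed.

Lemma ex_sum (I : Type) (r : seq I) (P : pred I) (F : I -> env d -> R) :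
  (forall i, local (F i)) ->
  Ex (fun om => \sum_(i <- r | P i) F i om) = \sum_(i <- r | P i) Ex (F i).
Proof.
move=> FL; elim: r => [|i r IH].
  by rewrite [RHS]big_nil -[RHS]ex0; congr Ex; apply/funext => om; rewrite big_nil.
rewrite big_cons; case Pi : (P i).
  rewrite -IH -exD ?FL //; last exact: local_sum.
  by congr Ex; apply/funext => om; rewrite big_cons Pi.
by rewrite -IH; congr Ex; apply/funext => om; rewrite big_cons Pi.
Qed.

Lemma ex_le f g : local f -> local g -> (forall om, f om <= g om) -> Ex f <= Ex g.
Proof.
move=> fL gL fg; rewrite -subr_ge0 -mulN1r -exZ // -exD //; last exact: localZ.
by apply: (ex_ge0 ExP) => [|om]; [apply: localD => //; exact: localZ|rewrite mulN1r subr_ge0].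
Qed.

Lemma ex_cst c : Ex (fun=> c) = c.
Proof.
rewrite -[RHS]mulr1; have -> : 1 = Ex (fun=> 1) :> R.
  by have := ex_cylinder ExP (fun _ : site d => (Ordinal d_gt0, true)) (erefl : uniq [::]);
    rewrite big_nil /= => {1}<-; congr Ex; apply/funext => om; rewrite /cyl_indic eqxx.
by rewrite -exZ; [congr Ex; apply/funext => om; rewrite mulr1 | exact: local_cst].
Qed.

Lemma local_cyl (s : seq (site d)) t : local (cyl_indic R s t).
Proof.
exists s => om om' ag; rewrite /cyl_indic; congr (nat_of_bool (_ == _))%:R.
exact/eq_in_map.
Qed.

Definition pattern_env (s : seq (site d)) (t : seq (arrow d)) : env d :=
  fun x => nth (Ordinal d_gt0, true) t (index x s).

Lemma map_pattern_env s t : uniq s -> size t = size s -> map (pattern_env s t) s = t.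
Proof.
move=> us st; apply: (@eq_from_nth _ (Ordinal d_gt0, true)); rewrite size_map // => i si.
by rewrite (nth_map None) // /pattern_env index_uniq.
Qed.

Lemma pattern_env_map s om x : x \in s -> pattern_env s (map om s) x = om x.
Proof.
by move=> xs; rewrite /pattern_env (nth_map None) ?index_mem // nth_index.
Qed.

(** A local function is a finite combination of indicators of cylinders. *)
Lemma pattern_decomp s f om : (forall om om', agree s om om' -> f om = f om') ->
  f om = \sum_(t : (size s).-tuple (arrow d)) f (pattern_env s t) * cyl_indic R s t om.
Proof.
move=> fs; rewrite (bigD1 (map_tuple om (in_tuple s))) //= big1 ?addr0 => [|t tN].
  by rewrite /cyl_indic eqxx mulr1; apply: fs => x xs; rewrite pattern_env_map.
rewrite /cyl_indic; case: eqP => [E|_]; last by rewrite mulr0.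
by case/eqP: tN; apply/val_inj; rewrite /= E.
Qed.

(** It is enough to check cylinders. Adding the hand to the sites of a cylinder
    costs nothing and is what makes the criterion applicable to shifts along
    the hand arrow. *)
Lemma ex_invariant (A : env d -> env d) : local_map A ->
  (forall s a, uniq s -> None \in s ->
     Ex (cyl_indic R s (map a s) \o A) = \prod_(x <- s) mu p (a x)) ->
  forall f, local f -> Ex (f \o A) = Ex f.
Proof.
move=> AL hA f [s0 fs0].
(* The hand is added to the sites on which f depends. *)
pose s := undup (None :: s0); have us : uniq s by exact: undup_uniq.
have fs om om' : agree s om om' -> f om = f om'.
  by move=> ag; apply: fs0 => x xs; apply: ag; rewrite mem_undup inE xs orbT.
have Ns : None \in s by rewrite mem_undup mem_head.
have dec h : local_map h -> Ex (f \o h) =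
    \sum_(t : (size s).-tuple (arrow d)) f (pattern_env s t) * Ex (cyl_indic R s t \o h).
  move=> hL; rewrite -[LHS]/(Ex (fun om => f (h om))).
  have -> : (fun om => f (h om)) = fun om => \sum_(t : (size s).-tuple (arrow d))
      f (pattern_env s t) * (cyl_indic R s t \o h) om.
    by apply/funext => om; rewrite (pattern_decomp (h om) fs).
  have cL t : local (cyl_indic R s t \o h) by apply: local_comp => //; exact: local_cyl.
  by rewrite ex_sum => [|t]; [apply: eq_bigr => t _; exact: exZ|exact: localZ].
rewrite (dec _ AL) -[RHS]/(Ex (f \o idfun)) dec; last by move=> t; exists t.
apply: eq_bigr => t _; congr (_ * _); rewrite -[cyl_indic R s t \o idfun]/(cyl_indic R s t).
have -> : t = map (pattern_env s t) s :> seq _ by rewrite map_pattern_env ?size_tuple.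
by rewrite hA // (ex_cylinder ExP).
Qed.

Lemma cyl_reindex (r r' : site d -> site d) s a : cancel r r' -> uniq s ->
  Ex (cyl_indic R s (map a s) \o (fun om => om \o r)) = \prod_(x <- s) mu p (a x).
Proof.
move=> rK us.
have -> : cyl_indic R s (map a s) \o (fun om => om \o r) =
    cyl_indic R (map r s) (map (a \o r') (map r s)).
  apply/funext => om; rewrite /cyl_indic /= -!map_comp.
  by congr (nat_of_bool (_ == _))%:R; apply: eq_map => x /=; rewrite rK.
rewrite (ex_cylinder ExP) ?map_inj_uniq //; last exact: can_inj rK.
by rewrite big_map; apply: eq_bigr => x _; rewrite /= rK.
Qed.

Lemma ex_reindex (A : env d -> env d) (r r' : site d -> site d) :
  cancel r r' -> (forall om x, A om x = om (r x)) ->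
  forall f, local f -> Ex (f \o A) = Ex f.
Proof.
move=> rK Ar; apply: ex_invariant; first exact: local_map_reindex Ar.
have -> : A = (fun om => om \o r) by apply/funext => om; apply/funext => x; exact: Ar.
by move=> s a us _; exact: cyl_reindex rK us.
Qed.

Lemma ex_swap_if b f : local f -> Ex (f \o @swap_if d b) = Ex f.
Proof.
by case: b => // fL; exact: (ex_reindex (A := @env_swap d) (@swap_siteK d) (@env_swapE d) fL).
Qed.

Lemma ex_step a f : local f -> Ex (f \o @env_step d a) = Ex f.
Proof.
exact: (ex_reindex (A := @env_step d a) (shift_siteK (arrow_vec a)) (env_shiftE _)).
Qed.

(** On a cylinder that prescribes the hand arrow the shift is deterministic. *)
Lemma ex_step_hand f : local f -> Ex (f \o @env_step_hand d) = Ex f.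
Proof.
apply: ex_invariant; first exact: local_map_step_hand.
move=> s a us Ns.
rewrite -(cyl_reindex a (shift_siteK (arrow_vec (a None))) us); congr Ex.
apply/funext => om; rewrite /cyl_indic /=; congr (nat_of_bool _)%:R.
apply/eqP/eqP => /eq_in_map E; apply/eq_in_map => x xs.
  have aN : om None = a None := E None Ns.
  by rewrite -(E x xs) /env_step_hand env_shiftE aN.
have aN : om None = a None := E None Ns.
by rewrite -(E x xs) /env_step_hand env_shiftE aN.
Qed.

Lemma ex_move i f : local f -> Ex (f \o env_move i) = Ex f.
Proof.
move=> fL; case: i => [oa [b1 b2]].
have f1 : local (f \o @swap_if d b1) by apply: local_comp => //; exact: local_map_swap_if.
case: oa => [a|].
  rewrite -[f \o _]/(((f \o swap_if b1) \o env_step a) \o swap_if b2).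
  rewrite ex_swap_if ?ex_step ?ex_swap_if //.
  by apply: local_comp => //; exact: local_map_step.
rewrite -[f \o _]/(((f \o swap_if b1) \o @env_step_hand d) \o swap_if b2).
rewrite ex_swap_if ?ex_step_hand ?ex_swap_if //.
by apply: local_comp => //; exact: local_map_step_hand.
Qed.


(** The law mu_p is symmetric. *)
Lemma ex_flip x f : local f ->
  Ex (f \o (fun om y => if y == x then flip_arrow (om y) else om y)) = Ex f.
Proof.
have flipK : involutive (@flip_arrow d) by move=> [k b]; rewrite /flip_arrow negbK.
apply: ex_invariant => [|s a us _].
  apply: local_map_coord => y; exists [:: y] => om om' ag.
  by rewrite (ag y) // inE.
have -> : cyl_indic R s (map a s) \o
      (fun om y => if y == x then flip_arrow (om y) else om y) =
    cyl_indic R s (map (fun y => if y == x then flip_arrow (a y) else a y) s).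
  apply/funext => om; rewrite /cyl_indic /=; congr (nat_of_bool _)%:R.
  apply/eqP/eqP => /eq_in_map E; apply/eq_in_map => y /E /=;
    by case: eqP => // _ E'; apply: (can_inj flipK); rewrite flipK.
rewrite (ex_cylinder ExP) //; apply: eq_bigr => y _; by case: ifP.
Qed.
End Expectation.

(** * The Dirichlet form of the free moves *)

Section InnerProduct.
Variables (R : realType) (d : nat) (p : 'I_d -> R) (Ex : (env d -> R) -> R).
Hypothesis ExP : pi_expectation p Ex.
Hypothesis d_gt0 : (0 < d)%N.
Implicit Types (f g h : locfun R d).

Definition inner f g : R := Ex (fun om => f om * g om).

Local Notation dot := inner.

Lemma locfunM_local f g : local (fun om => f om * g om).
Proof. by apply: localM; exact: locfun_local. Qed.
Hint Resolve locfunM_local : core.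

Lemma dot_sym f g : dot f g = dot g f.
Proof. by congr Ex; apply/funext => om; rewrite mulrC. Qed.

Lemma dot_addl f g h : dot (f + g) h = dot f h + dot g h.
Proof. by rewrite -(exD ExP) //; congr Ex; apply/funext => om; rewrite mulrDl. Qed.

Lemma dot_scalel a f g : dot (a *: f) g = a * dot f g.
Proof. by rewrite -(exZ ExP) //; congr Ex; apply/funext => om; rewrite locfunE mulrA. Qed.

Lemma dot_self_ge0 f : 0 <= dot f f.
Proof. by apply: (ex_ge0 ExP) => // om; rewrite -expr2 sqr_ge0. Qed.

Let dotE := (dot_addl, dotDr dot_sym dot_addl, dotNl dot_scalel, dotNr dot_sym dot_scalel,
  dot_scalel, dotZr dot_sym dot_scalel).

Lemma dot_lcomp A (AL : local_map A) f g :
  (forall f : env d -> R, local f -> Ex (f \o A) = Ex f) ->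
  dot (lcomp AL f) (lcomp AL g) = dot f g.
Proof.
by move=> hA; rewrite /inner -[RHS]hA //; congr Ex; apply/funext => om; rewrite !lcompE.
Qed.

Lemma dot_pull i f g : dot (pull i f) (pull i g) = dot f g.
Proof. by apply: dot_lcomp => k; exact: (ex_move ExP). Qed.

Definition lswap b : locfun R d -> locfun R d := lcomp (@local_map_swap_if d b).
Definition lstep a : locfun R d -> locfun R d := lcomp (@local_map_step d a).

Lemma dot_lswap b f g : dot (lswap b f) (lswap b g) = dot f g.
Proof. by apply: dot_lcomp => k; exact: (ex_swap_if ExP). Qed.

Lemma dot_lstep a f g : dot (lstep a f) (lstep a g) = dot f g.
Proof. by apply: dot_lcomp => k; exact: (ex_step ExP). Qed.

Lemma lswapK b : involutive (lswap b).
Proof.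
by move=> f; apply: locfun_ext => om; rewrite 2!lcompE swap_ifK.
Qed.

Lemma dot_lswap_adj b f g : dot f (lswap b g) = dot (lswap b f) g.
Proof. by rewrite -{1}(lswapK b f) dot_lswap. Qed.

Definition free_op f : locfun R d := \sum_i free_rate R i *: (pull i f - f).
Definition gen_op m eps f : locfun R d := \sum_i jump_rate m eps i *: (pull i f - f).

Lemma dot_pull_le i f : dot f (pull i f) <= dot f f.
Proof.
by have := dot_parallelogram dot_sym dot_addl dot_scalel dot_self_ge0 f (pull i f);
  rewrite dot_pull; lra.
Qed.

Lemma dot_pull_ge i f : - dot f f <= dot f (pull i f).
Proof.
have := dot_parallelogram dot_sym dot_addl dot_scalel dot_self_ge0 f (- pull i f).
by rewrite !dotE dot_pull; lra.
Qed.

Lemma dot_free_op g f : dot g (free_op f) =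
  \sum_i free_rate R i * (dot g (pull i f) - dot g f).
Proof.
rewrite (dot_sumr dot_sym dot_addl dot_scalel).
by apply: eq_bigr => i _; rewrite !dotE.
Qed.

Lemma dot_gen_op m eps g f : dot g (gen_op m eps f) =
  \sum_i jump_rate m eps i * (dot g (pull i f) - dot g f).
Proof.
rewrite (dot_sumr dot_sym dot_addl dot_scalel).
by apply: eq_bigr => i _; rewrite !dotE.
Qed.

Lemma free_op_le0 f : dot f (free_op f) <= 0.
Proof.
rewrite dot_free_op; apply: sumr_le0 => i _.
by rewrite mulr_ge0_le0 ?free_rate_ge0 // subr_le0 dot_pull_le.
Qed.

Lemma gen_op_le m eps f : dot f (gen_op m eps f) <= eps * dot f (free_op f).
Proof.
rewrite dot_free_op dot_gen_op mulr_sumr; apply: ler_sum => i _.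
rewrite mulrA -subr_ge0 -mulrBl /jump_rate.
have -> : eps * free_rate R i - (hand_rate R m i + eps * free_rate R i) = - hand_rate R m i.
  by ring.
by rewrite mulNr oppr_ge0 mulr_ge0_le0 ?hand_rate_ge0 // subr_le0 dot_pull_le.
Qed.

(** U is the average of contractions minus the identity. *)
Lemma free_op_ge f : - (2 * dot f f) <= dot f (free_op f).
Proof.
have -> : - (2 * dot f f) = \sum_(i : jump d) free_rate R i * - (2 * dot f f).
  by rewrite -mulr_suml free_rate_sum // mul1r.
rewrite dot_free_op; apply: ler_sum => i _; rewrite ler_wpM2l ?free_rate_ge0 //.
by have := dot_pull_ge i f; lra.
Qed.

Lemma free_opB f g : free_op (f - g) = free_op f - free_op g.
Proof.
apply: locfun_ext => om; rewrite !locfunE -sumrB; apply: eq_bigr => i _.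
by rewrite !locfunE; ring.
Qed.

Lemma free_op_sym f g : dot g (free_op f) = dot (free_op g) f.
Proof.
rewrite [RHS]dot_sym !dot_free_op [RHS](reindex_inj (inv_inj (@reverse_moveK d))) /=.
apply: eq_bigr => i _; rewrite free_rate_reverse (dot_sym f g).
have [->|nz] := eqVneq (free_rate R i) 0; first by rewrite !mul0r.
congr (_ * (_ - _)); rewrite dot_sym -(dot_pull i f).
congr dot; apply: locfun_ext => om; by rewrite !locfunE (env_move_reverse _ nz).
Qed.

Definition lavg f : locfun R d := 2^-1 *: (f + lswap true f).

(** The swaps before and after a free step average f into
    g = (f + f o sigma) / 2, so U is a step of the random walk applied to g. The
    first term is the loss |f|^2 - |g|^2, and the second one is
    <g, g - tau_e g> = |g - tau_e g|^2 / 2 for the isometries tau_e. *)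
Lemma dirichlet_form f : - dot f (free_op f) =
  4^-1 * dot (f - lswap true f) (f - lswap true f) +
  (4 * d%:R)^-1 * \sum_a dot (lavg f - lstep a (lavg f)) (lavg f - lstep a (lavg f)).
Proof.
have pullE' a b1 b2 : dot f (pull (Some a, (b1, b2)) f) =
    dot (lswap b2 f) (lstep a (lswap b1 f)).
  by rewrite -dot_lswap_adj; congr dot; apply: locfun_ext => om; rewrite !locfunE.
have lswapF : lswap false f = f by apply: locfun_ext => om; rewrite lcompE.
have lstepD a g h : lstep a (g + h) = lstep a g + lstep a h by apply: locfun_ext => om; rewrite !locfunE.
have lstepZ a c g : lstep a (c *: g) = c *: lstep a g by apply: locfun_ext => om; rewrite !locfunE.
rewrite dot_free_op sum_move big1 ?add0r => [|b _]; last by rewrite /free_rate mul0r.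
(* The sum over the four choices of swaps, for one direction a. *)
pose k : R := ((2 * d)%:R * 4)^-1.
have inner a : \sum_(b : bool * bool) free_rate R (Some a, b) *
      (dot f (pull (Some a, b) f) - dot f f) =
    - k * (dot (f - lswap true f) (f - lswap true f)
     + 2 * dot (lavg f - lstep a (lavg f)) (lavg f - lstep a (lavg f))).
  rewrite sum_bool2 /free_rate /= -/k !pullE' !lswapF /lavg !lstepZ !lstepD !dotE.
  rewrite !dot_lstep !dot_lswap (dot_sym (lswap true f) f).
  rewrite !(dot_sym (lstep a _) f) !(dot_sym (lstep a _) (lswap true f)).
  by field.
under eq_bigr do rewrite inner.
rewrite -mulr_sumr big_split /= sumr_const card_prod card_ord card_bool -mulr_sumr.
have d0 : d%:R != 0 :> R by rewrite pnatr_eq0 -lt0n.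
rewrite /k natrM -[_ *+ (d * 2)]mulr_natr natrM; field.
by rewrite d0.
Qed.
End InnerProduct.

(** * Correlations with the arrows near the walker *)

Section Spins.
Variables (R : realType) (d : nat) (p : 'I_d -> R) (Ex : (env d -> R) -> R).
Hypothesis ExP : pi_expectation p Ex.
Hypothesis d_gt0 : (0 < d)%N.
Implicit Types (f g h : locfun R d).

Local Notation dot := (inner Ex).
Let dotC := @dot_sym R d Ex.
Let dotD := dot_addl ExP.
Let dotZ := dot_scalel ExP.
Let dot0 := dot_self_ge0 ExP.
Let dotE := (dotD, dotDr dotC dotD, dotNl dotZ, dotNr dotC dotZ, dotZ, dotZr dotC dotZ).

Definition arrow_comp (i : 'I_d) (a : arrow d) : R := (arrow_vec a ord0 i)%:~R.

Lemma arrow_compE i a : arrow_comp i a = if i == a.1 then (-1) ^+ a.2 else 0.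
Proof.
rewrite /arrow_comp /arrow_vec !mxE eqxx /=; case: eqP => _; last by rewrite mulr0.
by rewrite mulr1; case: a.2; rewrite ?expr1 ?expr0.
Qed.

Lemma arrow_comp_flip i a : arrow_comp i (flip_arrow a) = - arrow_comp i a.
Proof. by rewrite /arrow_comp arrow_vec_flip mxE mulrNz. Qed.

Lemma arrow_comp_sqr i a : arrow_comp i a ^+ 2 = (i == a.1)%:R.
Proof. by rewrite arrow_compE; case: eqP => _; rewrite ?expr0n // sqrr_sign. Qed.

Lemma arrow_comp_sqr_sum a : \sum_i arrow_comp i a ^+ 2 = 1.
Proof.
rewrite (bigD1 a.1) //= big1 ?addr0 ?arrow_comp_sqr ?eqxx // => i /negPf ia.
by rewrite arrow_comp_sqr ia.
Qed.

Definition spin (x : site d) (i : 'I_d) : locfun R d := to_locfun (local_at x (arrow_comp i)).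

Lemma spinE x i om : spin x i om = arrow_comp i (om x).
Proof. by []. Qed.

(** Flipping the arrow at x changes the sign of the product. *)
Lemma spin_orth x y i : x != y -> dot (spin x i) (spin y i) = 0.
Proof.
move=> xy; suff : dot (spin x i) (spin y i) = - dot (spin x i) (spin y i) by lra.
rewrite {1}/inner -(ex_flip ExP d_gt0 x); last exact: locfunM_local.
set F := (fun om => _) \o _.
have -> : F = fun om => -1 * (spin x i om * spin y i om).
  apply/funext => om; rewrite /F /= eqxx (negPf (_ : y != x)) 1?eq_sym //.
  by rewrite arrow_comp_flip mulN1r mulNr.
by rewrite (exZ ExP) ?mulN1r //; exact: locfunM_local.
Qed.

Lemma spin_norm_sum x : \sum_i dot (spin x i) (spin x i) = 1.
Proof.
rewrite -(ex_sum ExP) => [|i]; last exact: locfunM_local.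
rewrite -[RHS](ex_cst ExP d_gt0); congr Ex; apply/funext => om.
by rewrite -(arrow_comp_sqr_sum (om x)); apply: eq_bigr => i _; rewrite spinE expr2.
Qed.

Lemma spin_norm_le1 x i : dot (spin x i) (spin x i) <= 1.
Proof.
by rewrite -(spin_norm_sum x) (bigD1 i) //= lerDl; apply: sumr_ge0 => j _; exact: dot0.
Qed.

Lemma lstep_spin a y i : lstep a (spin (Some y) i) = spin (Some (y + arrow_vec a)) i.
Proof. by apply: locfun_ext => om; rewrite locfunE !spinE. Qed.

Section Octant.
Hypothesis hd : (3 <= d)%N.

Definition octant (x y z : nat) : 'rV[int]_d :=
  \row_(j < d) (nth 0%N [:: x; y; z] j)%:Z.

Lemma octant_inj x y z x' y' z' : octant x y z = octant x' y' z' ->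
  [/\ x = x', y = y' & z = z'].
Proof.
move=> /rowP E.
have ev (k : nat) (k3 : (k < 3)%N) :
    nth 0%N [:: x; y; z] k = nth 0%N [:: x'; y'; z'] k.
  have := E (Ordinal (leq_trans k3 hd)); rewrite !mxE /= => /eqP.
  by rewrite eqz_nat => /eqP.
by split; [exact: (ev 0%N)|exact: (ev 1%N)|exact: (ev 2%N)].
Qed.

(** The octant of Z^3 sits in the first three coordinates of Z^d. *)
Definition octant_arrow k (k3 : (k < 3)%N) : arrow d := (Ordinal (leq_trans k3 hd), false).

Lemma octant_step k (k3 : (k < 3)%N) x y z :
  octant x y z + arrow_vec (octant_arrow k3) =
  octant (x + (k == 0))%N (y + (k == 1))%N (z + (k == 2))%N.
Proof.
apply/rowP => j; rewrite /arrow_vec /= expr0 scale1r !mxE /= -val_eqE /=.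
case: j => j jd /=; case: k k3 => [|[|[|//]]] _; case: j jd => [|[|[|j]]] _ //=;
  by rewrite ?addr0 ?addn0 // -PoszD.
Qed.

Lemma cube_bessel (N : nat) (v : nat -> nat -> nat -> site d) i g :
  (forall x y z x' y' z', v x y z = v x' y' z' -> [/\ x = x', y = y' & z = z']) ->
  cube_sum N (fun x y z => dot (spin (v x y z) i) g ^+ 2) <= dot g g.
Proof.
move=> vinj; rewrite cube_sumE.
apply: (bessel_le dotC dotD dotZ dot0
  (e := fun u : 'I_N * ('I_N * 'I_N) => spin (v u.1 u.2.1 u.2.2) i)) => [u u' uu'|u].
  apply: spin_orth; apply: contra uu' => /eqP /vinj[].
  move: u u' => [x [y z]] [x' [y' z']] /= /val_inj -> /val_inj -> /val_inj ->.
  by rewrite eqxx.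
exact: spin_norm_le1.
Qed.

(** The correlation b(v) of g with the arrow at v satisfies
    b(v) - b(v + e) = <spin (v + e), tau_e g - g>. By Bessel's inequality the
    energy of b in direction e is at most |g - tau_e g|^2, and transience of Z^3
    bounds b(0). *)
Lemma spin_origin_bound i g :
  dot (spin (Some 0) i) g ^+ 2 <=
  16 * \sum_a dot (g - lstep a g) (g - lstep a g).
Proof.
pose b x y z := dot (spin (Some (octant x y z)) i) g.
pose D k (k3 : (k < 3)%N) := dot (g - lstep (octant_arrow k3) g) (g - lstep (octant_arrow k3) g).
have hb k (k3 : (k < 3)%N) N : cube_sum N (fun x y z =>
    (b x y z - b (x + (k == 0))%N (y + (k == 1))%N (z + (k == 2))%N) ^+ 2) <= D _ k3.
  set a := octant_arrow k3.
  have -> : D _ k3 = dot (lstep a g - g) (lstep a g - g).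
    by rewrite /D -/a -[lstep a g - g]opprB (dotNl dotZ) (dotNr dotC dotZ) opprK.
  pose v x y z : site d := Some (octant (x + (k == 0))%N (y + (k == 1))%N (z + (k == 2))%N).
  have -> : cube_sum N (fun x y z =>
      (b x y z - b (x + (k == 0))%N (y + (k == 1))%N (z + (k == 2))%N) ^+ 2)
    = cube_sum N (fun x y z => dot (spin (v x y z) i) (lstep a g - g) ^+ 2).
    apply: eq_cube_sum => x y z _ _ _; congr (_ ^+ 2).
    rewrite /b -(dot_lstep ExP d_gt0 a) lstep_spin octant_step -/(v x y z).
    by rewrite [RHS](dotDr dotC dotD) (dotNr dotC dotZ).
  apply: cube_bessel => x y z x' y' z' [] /octant_inj[] + + +.
  by do 3!move=> /addIn ?.
have oct0 : octant 0 0 0 = 0.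
  by apply/rowP => j; rewrite !mxE; case: j => [[|[|[|j]]] ?] //=; rewrite nth_nil.
have -> : dot (spin (Some 0) i) g = b 0%N 0%N 0%N by rewrite /b oct0.
have h0 : (0 < 3)%N by []. have h1 : (1 < 3)%N by []. have h2 : (2 < 3)%N by [].
have := @transient_point_bound R b (D _ h0) (D _ h1) (D _ h2) (dot g g).
move=> /(_ _ _ _ _)/le_trans; apply.
- move=> N; apply: le_trans (hb _ h0 N); rewrite le_eqVlt; apply/orP; left; apply/eqP.
  by apply: eq_cube_sum => x y z _ _ _; rewrite !addn0 addn1.
- move=> N; apply: le_trans (hb _ h1 N); rewrite le_eqVlt; apply/orP; left; apply/eqP.
  by apply: eq_cube_sum => x y z _ _ _; rewrite !addn0 addn1.
- move=> N; apply: le_trans (hb _ h2 N); rewrite le_eqVlt; apply/orP; left; apply/eqP.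
  by apply: eq_cube_sum => x y z _ _ _; rewrite !addn0 addn1.
- by move=> N; apply: cube_bessel => x y z x' y' z' [] /octant_inj.
rewrite ler_wpM2l //.
have a01 : octant_arrow h1 != octant_arrow h0 by [].
have a02 : octant_arrow h2 != octant_arrow h0 by [].
have a12 : octant_arrow h2 != octant_arrow h1 by [].
rewrite (bigD1 (octant_arrow h0)) //= (bigD1 (octant_arrow h1)) //=.
rewrite (bigD1 (octant_arrow h2)) ?a02 //= !addrA lerDl.
by apply: sumr_ge0 => a _; exact: dot0.
Qed.

Definition spin_const : R := 2 + 128 * d%:R.

(** Write f = g + (f - f o sigma) / 2. Since g is invariant under the swap, the
    arrow in the hand and the arrow at 0 have the same correlation with g,
    controlled by transience; the remainder is controlled by the first term of
    the Dirichlet form. *)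
Lemma spin_energy_bound b i f :
  dot (lswap b (spin None i)) f ^+ 2 <= spin_const * - dot f (free_op f).
Proof.
set g := lavg f; pose u := f - lswap true f.
have fE : f = g + 2^-1 *: u.
  by apply: locfun_ext => om; rewrite /g /u /lavg !locfunE; field.
have swg b' : lswap b' g = g.
  apply: locfun_ext => om; rewrite /g /lavg !locfunE; case: b' => //=.
  by rewrite env_swapK addrC.
have e0 : dot (lswap b (spin None i)) g = dot (spin (Some 0) i) g.
  have s0 : spin (Some 0) i = lswap true (spin None i).
    by apply: locfun_ext => om; rewrite lcompE !spinE.
  by rewrite s0 -!(dot_lswap_adj ExP d_gt0) !swg.
rewrite (dirichlet_form ExP d_gt0) -/g -/u.
set DS := \sum_a _.
have DS0 : 0 <= DS by apply: sumr_ge0 => a _; exact: dot0.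
have h1 : dot (lswap b (spin None i)) u ^+ 2 <= dot u u.
  apply: (le_trans (dot_cauchy_schwarz dotC dotD dotZ dot0 _ _)).
  by rewrite ler_piMl ?dot0 // (dot_lswap ExP d_gt0) spin_norm_le1.
have h2 : dot (spin (Some 0) i) g ^+ 2 <= 16 * DS by exact: spin_origin_bound.
clearbody g u; rewrite {1}fE !dotE e0.
have d1 : 0 < d%:R :> R by rewrite ltr0n.
have -> : spin_const * (4^-1 * dot u u + (4 * d%:R)^-1 * DS) =
   (2 + 128 * d%:R) / 4 * dot u u + (2^-1 / d%:R + 32) * DS.
  by rewrite /spin_const; field; rewrite gt_eqF.
have : 0 <= d%:R * dot u u by rewrite mulr_ge0 ?dot0 // ltW.
have : 0 <= 2^-1 / d%:R * DS by rewrite mulr_ge0 // divr_ge0 // ltW.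
have := sqr_ge0 (dot (spin (Some 0) i) g - 2^-1 * dot (lswap b (spin None i)) u).
have := dot0 u.
nra.
Qed.
End Octant.
End Spins.

(** * The second moment of the discrete-time walk *)

Section Energy.
Variables (R : realType) (d : nat) (p : 'I_d -> R) (Ex : (env d -> R) -> R).
Hypothesis ExP : pi_expectation p Ex.
Hypothesis hd : (3 <= d)%N.
Variables (m : model) (eps th : R).
Hypotheses (eps_gt0 : 0 < eps) (th_gt0 : 0 < th).
Hypotheses (th_eps : th * (1 + 2 * eps) <= 1) (th_d : th * d%:R <= 1).
Implicit Types (f g h : locfun R d).

Let d_gt0 : (0 < d)%N := leq_trans (isT : (0 < 3)%N) hd.
Local Notation dot := (inner Ex).
Let dotC := @dot_sym R d Ex.
Let dotD := dot_addl ExP.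
Let dotZ := dot_scalel ExP.
Let dot0 := dot_self_ge0 ExP.
Let dotE := (dotD, dotDr dotC dotD, dotNl dotZ, dotNr dotC dotZ, dotZ, dotZr dotC dotZ).

Local Notation hand := (spin R None).
Local Notation rate := (jump_rate m eps).

(** The component j of the mean velocity contributed by the hand moves; the
    free moves have mean 0. *)
Definition drift (j : 'I_d) : locfun R d :=
  match m with M1 => hand j | M2 => 2^-1 *: (hand j + lswap true (hand j)) end.

(** The component j of the arrow along which the walker has just moved, averaged
    over the hand moves, seen from the environment after the move: in M1 the
    swap has left this arrow at 0. *)
Definition codrift (j : 'I_d) : locfun R d :=
  match m with M1 => lswap true (hand j) | M2 => 2^-1 *: (hand j + lswap true (hand j)) end.

Lemma arrow_comp_sum0 j : \sum_(a : arrow d) arrow_comp R j a = 0.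
Proof.
have flipK : involutive (@flip_arrow d) by move=> [k b]; rewrite /flip_arrow negbK.
pose S : R := \sum_a arrow_comp R j a; rewrite -[LHS]/S.
suff : S = - S by lra.
rewrite {1}/S (reindex_inj (inv_inj flipK)) -sumrN.
by apply: eq_bigr => a _; exact: arrow_comp_flip.
Qed.

Lemma lswapF f : lswap false f = f.
Proof. by apply: locfun_ext => om; rewrite lcompE. Qed.

Lemma driftE j om : drift j om = match m with
  | M1 => arrow_comp R j (om None)
  | M2 => 2^-1 * (arrow_comp R j (om None) + arrow_comp R j (om (Some 0))) end.
Proof. by rewrite /drift; case: m => //; congr (_ * (_ + _)); exact: lcompE. Qed.

Lemma drift_sum j om : \sum_i rate i * arrow_comp R j (move_arrow i om) = drift j om.
Proof.
rewrite sum_move addrC exchange_big big1 ?add0r => [|b _]; last first.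
  by rewrite /jump_rate /hand_rate /free_rate /= -mulr_sumr arrow_comp_sum0 mulr0.
rewrite sum_bool2 driftE /jump_rate /hand_rate /free_rate /move_arrow /=.
by case: m => /=; [ring|field].
Qed.

(** The shift along the hand arrow does not change that arrow, so the arrow
    followed is still visible after the move: in the hand, or at 0 if a swap
    comes next. *)
Lemma dot_hand_pull j b1 b2 f :
  dot (lswap b2 (hand j)) (pull (None, (b1, b2)) f) = dot (lswap b1 (hand j)) f.
Proof.
rewrite -[RHS](dot_lswap_adj ExP d_gt0) /inner.
pose F om := hand j om * lswap b1 f om.
have FL : local F by exact: locfunM_local.
transitivity (Ex ((F \o @env_step_hand d) \o @swap_if d b2)); last first.
  rewrite (ex_swap_if ExP d_gt0) ?(ex_step_hand ExP d_gt0 FL) //.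
  exact: (local_comp FL (@local_map_step_hand d)).
by congr Ex; apply/funext => om; rewrite /F /= !lcompE.
Qed.

(** Changing variables to the environment after the move turns the arrow
    followed into codrift; the free moves cancel by symmetry. *)
Lemma ex_codrift j f : Ex (fun om => \sum_i rate i * (arrow_comp R j (move_arrow i om) * f (env_move i om)))
  = dot (codrift j) f.
Proof.
have L1 i : local (fun om => arrow_comp R j (move_arrow i om) * f (env_move i om)).
  apply: localM; first exact: local_move_arrow.
  exact: (local_comp (locfun_local f) (@local_env_move d i)).
rewrite (ex_sum ExP) => [|i]; last exact: localZ.
under eq_bigr => i _ do rewrite (exZ ExP) //.
have freeE a b : Ex (fun om => arrow_comp R j (move_arrow (Some a, b) om) *
    f (env_move (Some a, b) om)) = arrow_comp R j a * Ex f.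
  rewrite -(ex_move ExP d_gt0 (Some a, b) (locfun_local f)) -(exZ ExP) //.
  exact: (local_comp (locfun_local f) (@local_env_move d _)).
rewrite sum_move addrC exchange_big big1 ?add0r => [|b _]; last first.
  under eq_bigr => a _ do rewrite freeE mulrA /jump_rate /hand_rate /free_rate /=.
  by rewrite -mulr_suml -mulr_sumr arrow_comp_sum0 mulr0 mul0r.
have handE b1 b2 : Ex (fun om => arrow_comp R j (move_arrow (None, (b1, b2)) om) *
    f (env_move (None, (b1, b2)) om)) = dot (lswap b1 (hand j)) f.
  rewrite -(dot_hand_pull j b1 b2); congr Ex; apply/funext => om.
  by rewrite lcompE pullE.
rewrite sum_bool2 !handE /jump_rate /hand_rate /free_rate /codrift mulr0 !addr0.
by case: m => /=; rewrite ?dotE lswapF; field.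
Qed.

(** th *: resp k is the mean displacement of the walker in k steps, as a function
    of the initial environment. *)
Fixpoint resp (k : nat) (j : 'I_d) : locfun R d :=
  if k is k'.+1 then resp k' j + th *: gen_op m eps (resp k' j) + drift j else 0.

(** The mean of |X_k|^2 for the walk started at 0, as a function of the initial
    environment. *)
Fixpoint gain (k : nat) (om : env d) : R :=
  if k is k'.+1 then
    gain k' om + th * (\sum_i rate i * (gain k' (env_move i om) - gain k' om))
    + th * (1 + eps)
    + 2 * th ^+ 2 * \sum_j \sum_i rate i *
         (arrow_comp R j (move_arrow i om) * resp k' j (env_move i om))
  else 0.

Definition lazy_step (F : state d -> R) (z : state d) : R := F z + th * generator m eps F z.

Lemma arrow_comp_sqnorm (x : 'rV[int]_d) a :
  sqnorm R (x + arrow_vec a) = sqnorm R x + 2 * (\sum_j (x ord0 j)%:~R * arrow_comp R j a) + 1.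
Proof.
rewrite -[X in _ = _ + X](arrow_comp_sqr_sum R a) mulr_sumr -!big_split; apply: eq_bigr => j _ /=.
by rewrite mxE rmorphD /= -/(arrow_comp R j a); ring.
Qed.

Lemma gen_opE f om : gen_op m eps f om = \sum_i rate i * (f (env_move i om) - f om).
Proof. by rewrite !locfunE; apply: eq_bigr => i _; rewrite !locfunE. Qed.

(** One step of the walk maps |x|^2 + 2 th x . f(om) + r(om) to a function of
    the same form. *)
Lemma iter_sqnorm k z : iter k lazy_step (fun z => sqnorm R z.2) z =
  sqnorm R z.2 + 2 * th * (\sum_j (z.2 ord0 j)%:~R * resp k j z.1) + gain k z.1.
Proof.
elim: k z => [|k IH] [om x] /=.
  by rewrite big1 ?mulr0 ?addr0 // => j _; exact: mulr0.
rewrite {1}/lazy_step IH generatorE.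
have step i : rate i * (iter k lazy_step (fun z => sqnorm R z.2) (st_move i (om, x)) -
     iter k lazy_step (fun z => sqnorm R z.2) (om, x)) =
   rate i + 2 * (\sum_j (x ord0 j)%:~R * (rate i * arrow_comp R j (move_arrow i om)))
   + 2 * th * (\sum_j (x ord0 j)%:~R * (rate i * (resp k j (env_move i om) - resp k j om)))
   + 2 * th * (\sum_j rate i * (arrow_comp R j (move_arrow i om) * resp k j (env_move i om)))
   + rate i * (gain k (env_move i om) - gain k om).
  rewrite !IH /= arrow_comp_sqnorm.
  have -> : \sum_j ((x + arrow_vec (move_arrow i om)) ord0 j)%:~R * resp k j (env_move i om)
     = \sum_j (x ord0 j)%:~R * resp k j (env_move i om)
     + \sum_j arrow_comp R j (move_arrow i om) * resp k j (env_move i om).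
    by rewrite -big_split; apply: eq_bigr => j _ /=; rewrite mxE rmorphD /= mulrDl.
  have -> : \sum_j (x ord0 j)%:~R * (rate i * (resp k j (env_move i om) - resp k j om))
     = rate i * (\sum_j (x ord0 j)%:~R * resp k j (env_move i om)
        - \sum_j (x ord0 j)%:~R * resp k j om).
    by rewrite -sumrB mulr_sumr; apply: eq_bigr => j _ /=; ring.
  have -> : \sum_j (x ord0 j)%:~R * (rate i * arrow_comp R j (move_arrow i om))
     = rate i * (\sum_j (x ord0 j)%:~R * arrow_comp R j (move_arrow i om)).
    by rewrite mulr_sumr; apply: eq_bigr => j _ /=; ring.
  by rewrite -[in RHS]mulr_sumr; ring.
rewrite (eq_bigr _ (fun i _ => step i)).
rewrite !big_split /= -!mulr_sumr hand_rate_sum (free_rate_sum R d_gt0) mulr1.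
rewrite ![\sum_i \sum_(_ < _) _]exchange_big /=.
have -> : \sum_j \sum_i (x ord0 j)%:~R * (rate i * arrow_comp R j (move_arrow i om))
   = \sum_j (x ord0 j)%:~R * drift j om.
  by apply: eq_bigr => j _; rewrite -mulr_sumr drift_sum.
have -> : \sum_j \sum_i (x ord0 j)%:~R * (rate i * (resp k j (env_move i om) - resp k j om))
   = \sum_j (x ord0 j)%:~R * gen_op m eps (resp k j) om.
  by apply: eq_bigr => j _; rewrite -mulr_sumr gen_opE.
have -> : \sum_j (x ord0 j)%:~R * (resp k j + th *: gen_op m eps (resp k j) + drift j) om
   = \sum_j (x ord0 j)%:~R * resp k j om
   + th * (\sum_j (x ord0 j)%:~R * gen_op m eps (resp k j) om)
   + \sum_j (x ord0 j)%:~R * drift j om.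
  have E j : (resp k j + th *: gen_op m eps (resp k j) + drift j) om =
    resp k j om + th * gen_op m eps (resp k j) om + drift j om by [].
  rewrite mulr_sumr -!big_split; apply: eq_bigr => j _; rewrite E.
  rewrite [RHS]/=; move: (resp k j om) (gen_op _ _ _ om) (drift j om) => u v w; ring.
by ring.
Qed.

Lemma gain_local k : local (gain k).
Proof.
elim: k => [|k IH]; first exact: local_cst.
have cL i (f : env d -> R) : local f -> local (fun om => f (env_move i om)).
  by move=> fL; exact: (local_comp fL (@local_env_move d i)).
apply: localD; [apply: localD; [apply: localD => //|exact: local_cst]|].
  by apply: localZ; apply: local_sum => i _; apply: localZ; apply: localB => //; exact: cL.
apply: localZ; apply: local_sum => j _; apply: local_sum => i _; apply: localZ.
apply: localM; first exact: local_move_arrow.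
exact/cL/locfun_local.
Qed.

Lemma ex_gain_step k : Ex (gain k.+1) =
  Ex (gain k) + th * (1 + eps) + 2 * th ^+ 2 * \sum_j dot (codrift j) (resp k j).
Proof.
have cL i (f : env d -> R) : local f -> local (fun om => f (env_move i om)).
  by move=> fL; exact: (local_comp fL (@local_env_move d i)).
have gL := gain_local k.
have dL i : local (fun om => gain k (env_move i om) - gain k om).
  by apply: localB => //; exact: cL.
have rL j i : local (fun om => rate i * (arrow_comp R j (move_arrow i om) * resp k j (env_move i om))).
  apply: localZ; apply: localM; first exact: local_move_arrow.
  exact/cL/locfun_local.
rewrite /=.
rewrite (exD ExP); last 2 first.
- apply: localD; [apply: localD => //|exact: local_cst].
  by apply: localZ; apply: local_sum => i _; exact: localZ.
- by apply: localZ; apply: local_sum => j _; apply: local_sum.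
rewrite (exD ExP); last 2 first.
- by apply: localD => //; apply: localZ; apply: local_sum => i _; exact: localZ.
- exact: local_cst.
rewrite (exD ExP) //; last by apply: localZ; apply: local_sum => i _; exact: localZ.
rewrite (ex_cst ExP d_gt0) (exZ ExP); last by apply: local_sum => i _; exact: localZ.
rewrite (exZ ExP); last by apply: local_sum => j _; apply: local_sum.
rewrite (ex_sum ExP) => [|i]; last exact: localZ.
rewrite big1 ?mulr0 ?addr0 => [|i _]; last first.
  rewrite (exZ ExP) //.
  have -> : (fun om => gain k (env_move i om) - gain k om) =
     fun om => (gain k \o env_move i) om + -1 * gain k om.
    by apply/funext => om; rewrite mulN1r.
  rewrite (exD ExP); [|exact: cL|exact: localZ].
  by rewrite (exZ ExP) // (ex_move ExP d_gt0) // mulN1r subrr mulr0.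
congr (_ + _ * _); rewrite (ex_sum ExP) => [|j]; last exact: local_sum.
by apply: eq_bigr => j _; exact: ex_codrift.
Qed.

Lemma swap_arrow_comp_le1 (j : 'I_d) (om : env d) b : `|lswap b (hand j) om| <= 1.
Proof.
rewrite lcompE spinE -(ler_sqr (x := `|_|)) ?nnegrE // real_normK ?num_real //.
by rewrite arrow_comp_sqr expr1n; case: eqP.
Qed.

Lemma drift_le1 j om : `|drift j om| <= 1.
Proof.
have h0 := swap_arrow_comp_le1 j om false; have h1 := swap_arrow_comp_le1 j om true.
rewrite lcompE in h0; rewrite lcompE in h1; rewrite driftE.
have {h0} : `|arrow_comp R j (om None)| <= 1 by [].
have {h1} : `|arrow_comp R j (om (Some 0))| <= 1 by [].
case: m => //; move: (arrow_comp _ _ _) (arrow_comp _ _ _) => u v.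
by rewrite !ler_norml => /andP[? ?] /andP[? ?]; apply/andP; split; lra.
Qed.

Lemma th_rate : th * (1 + eps) <= 1.
Proof.
have : 0 <= th * eps by rewrite mulr_ge0 ?ltW.
by move: th_eps; lra.
Qed.

Lemma lazy_contraction f : (forall om, `|f om| <= 1) ->
  forall om, `|(f + th *: gen_op m eps f) om| <= 1.
Proof.
move=> f1 om; have -> : (f + th *: gen_op m eps f) om = f om + th * gen_op m eps f om by [].
rewrite gen_opE; under eq_bigr do rewrite mulrBr.
rewrite sumrB -mulr_suml (rate_sum m eps d_gt0).
set S := \sum_i _.
have S1 : `|S| <= 1 + eps.
  rewrite /S -(rate_sum m eps d_gt0); apply: (le_trans (ler_norm_sum _ _ _)).
  apply: ler_sum => i _; have r0 := rate_ge0 m i (ltW eps_gt0).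
  by rewrite normrM (ger0_norm r0) ler_piMr.
have t1 := th_rate.
have -> : f om + th * (S - (1 + eps) * f om) = (1 - th * (1 + eps)) * f om + th * S by ring.
apply: (le_trans (ler_normD _ _)); rewrite !normrM (gtr0_norm th_gt0) ger0_norm; last lra.
have h1 : (1 - th * (1 + eps)) * `|f om| <= (1 - th * (1 + eps)) * 1.
  by rewrite ler_wpM2l //; lra.
have h2 : th * `|S| <= th * (1 + eps) by rewrite ler_wpM2l // ltW.
lra.
Qed.

(** The increment of resp at time k is Q^k drift, and Q is a contraction for
    the supremum norm. *)
Lemma resp_diff_le1 k j om : `|(resp k.+1 j - resp k j) om| <= 1.
Proof.
elim: k om => [|k IH] om.
  have -> : resp 1 j - resp 0 j = drift j.
    rewrite /= add0r subr0 (_ : gen_op m eps 0 = 0) ?scaler0 ?add0r //.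
    by rewrite /gen_op big1 // => i _; apply: locfun_ext => om'; rewrite !locfunE subrr mulr0.
  exact: drift_le1.
have -> : resp k.+2 j - resp k.+1 j =
    (resp k.+1 j - resp k j) + th *: gen_op m eps (resp k.+1 j - resp k j).
  have genB f g : gen_op m eps (f - g) = gen_op m eps f - gen_op m eps g.
    rewrite /gen_op -sumrB; apply: eq_bigr => i _; rewrite -scalerBr; congr (_ *: _).
    by apply: locfun_ext => om'; rewrite !locfunE; ring.
  rewrite [resp k.+2 j]/= -/(resp k.+1 j) genB scalerBr.
  have E1 : resp k.+1 j = resp k j + th *: gen_op m eps (resp k j) + drift j by [].
  have E2 : resp k.+1 j - resp k j = th *: gen_op m eps (resp k j) + drift j.
    by rewrite E1 -[resp k j + _ + _]addrA [resp k j + _]addrC addrK.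
  rewrite E2 -[resp k.+1 j + _ + _]addrA [resp k.+1 j + _]addrC addrK.
  by rewrite [RHS]addrC addrA subrK.
exact: lazy_contraction.
Qed.

Lemma resp_diff_norm k j : dot (resp k.+1 j - resp k j) (resp k.+1 j - resp k j) <= 1.
Proof.
rewrite -[leRHS](ex_cst ExP d_gt0); apply: (ex_le ExP); first exact: locfunM_local.
  exact: local_cst.
move=> om; have := resp_diff_le1 k j om; move: (lval _ om) => u.
by rewrite ler_norml => /andP[? ?]; nra.
Qed.

Lemma spin_const_ge0 : 0 <= spin_const R d.
Proof. by rewrite /spin_const addr_ge0 // mulr_ge0. Qed.

Lemma drift_energy j f : dot (drift j) f ^+ 2 <= spin_const R d * - dot f (free_op f).
Proof.
have h0 := spin_energy_bound ExP d_gt0 hd false j f.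
have h1 := spin_energy_bound ExP d_gt0 hd true j f.
rewrite lswapF in h0; rewrite /drift; case: m => //; rewrite !dotE.
have := sqr_ge0 (dot (hand j) f - dot (lswap true (hand j)) f); lra.
Qed.

Lemma codrift_energy j f : dot (codrift j) f ^+ 2 <= spin_const R d * - dot f (free_op f).
Proof.
have h0 := spin_energy_bound ExP d_gt0 hd false j f.
have h1 := spin_energy_bound ExP d_gt0 hd true j f.
rewrite lswapF in h0; rewrite /codrift; case: m => //; rewrite !dotE.
have := sqr_ge0 (dot (hand j) f - dot (lswap true (hand j)) f); lra.
Qed.

Definition gain_rate : R :=
  th * (1 + eps) + th ^+ 2 * (d%:R * (1 + 2 * (spin_const R d / (th * eps)))).

(** Summing the one-step estimates, the increments of |resp k j|^2 telescope. *)
Lemma gain_upper k : Ex (gain k) <= gain_rate * k%:R.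
Proof.
suff : Ex (gain k) <= gain_rate * k%:R - th ^+ 2 * \sum_j dot (resp k j) (resp k j).
  move/le_trans; apply; rewrite gerBl mulr_ge0 ?sqr_ge0 //.
  by apply: sumr_ge0 => j _; exact: dot0.
elim: k => [|k IH].
  rewrite /= (ex_cst ExP d_gt0) mulr0 big1 ?mulr0 ?subr0 // => j _.
  exact: (dot0l dotZ).
rewrite ex_gain_step.
have step : \sum_j 2 * dot (codrift j) (resp k j) <=
    \sum_(j < d) ((1 + 2 * (spin_const R d / (th * eps)))
      - (dot (resp k.+1 j) (resp k.+1 j) - dot (resp k j) (resp k j))).
  apply: ler_sum => j _.
  apply: (dissipative_step_upper dotC dotD dotZ (L := gen_op m eps) (U := @free_op R d)
    (phi := drift j) (f := resp k j) th_gt0 eps_gt0).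
  - exact: (gen_op_le ExP d_gt0).
  - exact: resp_diff_norm.
  - exact: spin_const_ge0.
  - exact: (free_op_le0 ExP d_gt0).
  - exact: drift_energy.
  - exact: codrift_energy.
move: step; rewrite -mulr_sumr sumrB sumrB sumr_const card_ord => step.
have th2 : 0 <= th ^+ 2 by exact: sqr_ge0.
have := ler_wpM2l th2 step.
rewrite -[_ *+ d]mulr_natl /gain_rate -(natr1 k).
move: IH; rewrite /gain_rate.
lra.
Qed.

(** The potential vanishes at time 0 and is nonnegative, so it may be carried
    along the induction. In M1 the exact identity |drift|^2 = 1 is used; in M2
    the loss th^2 d is absorbed because th d <= 1. *)
Lemma gain_lower k : th * eps * k%:R <= Ex (gain k).
Proof.
(* The two cases telescope different quantities. *)
pose pot f : R := match m with
  | M1 => th * (th * (dot f f - eps * dot f (free_op f)))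
  | M2 => th ^+ 2 * dot f f end.
have pot0 f : 0 <= pot f.
  rewrite /pot; case: m; last by rewrite mulr_ge0 ?sqr_ge0 ?dot0.
  rewrite !mulr_ge0 ?(ltW th_gt0) // subr_ge0; apply: le_trans (dot0 f).
  by rewrite mulr_ge0_le0 ?(ltW eps_gt0) // (free_op_le0 ExP d_gt0).
suff : th * eps * k%:R + \sum_j pot (resp k j) <= Ex (gain k).
  by apply: le_trans; rewrite lerDl; apply: sumr_ge0.
elim: k => [|k IH].
  rewrite /= (ex_cst ExP d_gt0) mulr0 add0r big1 // => j _.
  by rewrite /pot; case: m; rewrite !(dot0l dotZ) ?mulr0 ?subrr ?mulr0.
rewrite ex_gain_step.
suff step : th * eps + (\sum_j pot (resp k.+1 j) - \sum_j pot (resp k j)) <=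
    th * (1 + eps) + 2 * th ^+ 2 * \sum_j dot (codrift j) (resp k j).
  by move: IH step; rewrite -(natr1 k); lra.
have th2 : 0 <= th ^+ 2 by exact: sqr_ge0.
rewrite -sumrB /pot /codrift; case Em : m.
- have handA j f : dot (hand j) (pull (None, (true, false)) f) = dot (lswap true (hand j)) f.
    by rewrite -(dot_hand_pull j true false) lswapF.
  have step j : th * (dot (resp k.+1 j) (resp k.+1 j) - eps * dot (resp k.+1 j) (free_op (resp k.+1 j)))
      - th * (dot (resp k j) (resp k j) - eps * dot (resp k j) (free_op (resp k j)))
      <= dot (hand j) (hand j) + 2 * th * dot (lswap true (hand j)) (resp k j).
    rewrite -handA.
    have drE : drift j = hand j by rewrite /drift Em.
    rewrite -{1}drE -{1}drE -{1}drE.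
    apply: (isometry_step_lower dotC dotD dotZ dot0 (L := gen_op m eps) (U := @free_op R d)
      (f := resp k j) (drift j) th_gt0 eps_gt0 (A := pull (None, (true, false)))).
    + rewrite /gen_op /jump_rate Em; under eq_bigr do rewrite scalerDl.
      rewrite big_split /=; congr (_ + _); last first.
        by rewrite scaler_sumr; apply: eq_bigr => i _; rewrite scalerA.
      rewrite (bigD1 (None, (true, false))) //= scale1r big1 ?addr0 //.
      by move=> [[a|] [[] []]] //= _; rewrite scale0r.
    + by rewrite (dot_pull ExP d_gt0).
    + exact: free_opB.
    + by move=> g h; exact: (free_op_sym ExP d_gt0).
    + exact: (free_op_le0 ExP d_gt0).
    + exact: (free_op_ge ExP d_gt0).
    + exact: th_eps.
  pose pot1 f := th * (dot f f - eps * dot f (free_op f)).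
  have sum_step : \sum_j (pot1 (resp k.+1 j) - pot1 (resp k j)) <=
      1 + 2 * th * \sum_j dot (lswap true (hand j)) (resp k j).
    rewrite -[X in _ <= X + _](spin_norm_sum ExP d_gt0 None) mulr_sumr -big_split.
    by apply: ler_sum => j _; exact: step.
  have -> : \sum_j (th * pot1 (resp k.+1 j) - th * pot1 (resp k j))
     = th * \sum_j (pot1 (resp k.+1 j) - pot1 (resp k j)).
    by rewrite mulr_sumr; apply: eq_bigr => j _; rewrite mulrBr.
  have := ler_wpM2l (ltW th_gt0) sum_step.
  lra.
- have step j : dot (resp k.+1 j) (resp k.+1 j) - dot (resp k j) (resp k j) - 1
       <= 2 * dot (drift j) (resp k j).
    apply: (dissipative_step_lower dotC dotD dotZ (L := gen_op m eps) th_gt0 (phi := drift j)).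
      apply: (le_trans (gen_op_le ExP d_gt0 _ _ _)).
      by rewrite mulr_ge0_le0 ?(ltW eps_gt0) // (free_op_le0 ExP d_gt0).
    exact: resp_diff_norm.
  have drE j : drift j = 2^-1 *: (hand j + lswap true (hand j)) by rewrite /drift Em.
  under [in leRHS]eq_bigr do rewrite -drE.
  have sum_step : \sum_j (dot (resp k.+1 j) (resp k.+1 j) - dot (resp k j) (resp k j)) - d%:R
      <= 2 * \sum_j dot (drift j) (resp k j).
    have -> : d%:R = \sum_(j < d) 1 :> R by rewrite sumr_const card_ord.
    by rewrite -sumrB mulr_sumr; apply: ler_sum => j _; exact: step.
  have -> : \sum_j (th ^+ 2 * dot (resp k.+1 j) (resp k.+1 j) - th ^+ 2 * dot (resp k j) (resp k j))
     = th ^+ 2 * \sum_j (dot (resp k.+1 j) (resp k.+1 j) - dot (resp k j) (resp k j)).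
    by rewrite mulr_sumr; apply: eq_bigr => j _; rewrite mulrBr.
  have := ler_wpM2l th2 sum_step.
  have := ler_wpM2l (ltW th_gt0) th_d.
  lra.
Qed.
End Energy.

(** * Uniformization of the semigroup *)

Section CauchyProduct.
Variable R : realType.
Implicit Types (x y t K : R) (a : nat -> R).

Lemma exp_convolution x (al : nat -> R) N :
  \sum_(n < N) \sum_(j < n.+1) exp_coeff x (n - j)%N * al j =
  \sum_(j < N) al j * series (exp_coeff x) (N - j)%N.
Proof.
elim: N => [|N IH]; first by rewrite !big_ord0.
rewrite big_ord_recr /= IH [in RHS]big_ord_recr /= [in LHS]big_ord_recr /=.
rewrite subnn subSn // subnn addrA -big_split /=; congr (_ + _).
  apply: eq_bigr => j _; rewrite subSn ?(ltnW (ltn_ord j)) //.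
  by rewrite [in RHS]/series /= big_nat_recr //= mulrDr [X in _ + X]mulrC.
by rewrite /series /= big_nat1 mulrC.
Qed.

Lemma exp_coeffD x y n :
  \sum_(j < n.+1) exp_coeff x (n - j)%N * exp_coeff y j = exp_coeff (x + y) n.
Proof.
rewrite /exp_coeff /= exprDn mulr_suml; apply: eq_bigr => j _.
have jn : (j <= n)%N by rewrite -ltnS.
have := bin_fact jn => /(congr1 (fun k => k%:R : R)); rewrite !natrM => E.
have f0 k : k`!%:R != 0 :> R by rewrite pnatr_eq0 -lt0n fact_gt0.
rewrite -E -[_ *+ 'C(n, j)]mulr_natl; field.
by rewrite !f0 /= pnatr_eq0 -lt0n bin_gt0 jn.
Qed.

(** Cauchy product of the exponential series with a series dominated by
    exp_coeff y. The difference between the product of the partial sums and the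
    partial convolution is a sum of the same shape for the dominating series,
    where it tends to 0 because exp (x + y) = exp x * exp y. *)
Lemma cvg_exp_convolution x y K (al : nat -> R) : 0 <= x -> 0 <= y ->
  (forall n, `|al n| <= K * exp_coeff y n) ->
  (fun N => \sum_(n < N) \sum_(j < n.+1) exp_coeff x (n - j)%N * al j) @ \oo
    --> expR x * limn (series al).
Proof.
move=> x0 y0 alK.
have ec := @is_cvg_series_exp_coeff R.
have alc : cvgn (series al).
  apply: normed_cvg.
  apply: (@series_le_cvg _ (fun n => `|al n|) (fun n => K * exp_coeff y n)) => [n|n|n|] //.
    by apply: le_trans (alK n).
  by rewrite (_ : (fun n => _) = K *: exp_coeff y) //; exact: is_cvg_seriesZ.
(* err is the difference of partial sums for the dominating series. *)
pose B := series (exp_coeff x); pose E := series (exp_coeff y).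
pose C N := \sum_(n < N) \sum_(j < n.+1) exp_coeff x (n - j)%N * al j.
pose err N := K * (E N * B N - series (exp_coeff (x + y)) N).
have sE (u : nat -> R) N : series u N = \sum_(n < N) u n by rewrite /series /= big_mkord.
have Bmono N j : 0 <= B N - B (N - j)%N.
  rewrite subr_ge0 /B; have : {homo series (exp_coeff x) : m n / (m <= n)%N >-> m <= n}.
    by apply: nondecreasing_series => n _ _; exact: exp_coeff_ge0.
  by apply; rewrite leq_subr.
have Cerr N : `|series al N * B N - C N| <= err N.
  rewrite /C exp_convolution -/B sE mulr_suml -sumrB.
  apply: (le_trans (ler_norm_sum _ _ _)).
  have -> : err N = \sum_(j < N) K * exp_coeff y j * (B N - B (N - j)%N).
    rewrite /err (_ : series (exp_coeff (x + y)) N =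
      \sum_(n < N) \sum_(j < n.+1) exp_coeff x (n - j)%N * exp_coeff y j).
      rewrite exp_convolution -/B /E sE mulr_suml -sumrB mulr_sumr.
      by apply: eq_bigr => j _; ring.
    by rewrite sE; apply: eq_bigr => n _; rewrite exp_coeffD.
  apply: ler_sum => j _; rewrite -mulrBr normrM (ger0_norm (Bmono _ _)).
  by rewrite ler_wpM2r.
have err0 : err @ \oo --> (0 : R).
  rewrite -[0 in X in _ --> X](mulr0 K) -[X in K * X](subrr (expR (x + y))).
  apply: cvgMr; apply: cvgB; last exact: (ec (x + y)).
  by rewrite addrC expRD; apply: cvgM; [exact: (ec y)|exact: (ec x)].
have d0 : (fun N => series al N * B N - C N) @ \oo --> (0 : R).
  apply/cvgr0Pnorm_le => e e0; near=> N; apply: (le_trans (Cerr N)).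
  apply: le_trans (ler_norm _) _; near: N; by apply: cvgr0_norm_le.
have : (fun N => series al N * B N - (series al N * B N - C N)) @ \oo -->
    limn (series al) * expR x - 0.
  by apply: cvgB => //; apply: cvgM => //; exact: (ec x).
rewrite subr0 mulrC; apply: cvg_trans; apply: near_eq_cvg; apply: nearW => N.
by rewrite subKr.
Unshelve. all: by end_near. Qed.
End CauchyProduct.

Section Uniformization.
Variables (R : realType) (d : nat) (m : model) (eps c : R).
Hypotheses (d_gt0 : (0 < d)%N) (eps_gt0 : 0 < eps) (c_gt0 : 0 < c).
Implicit Types (F G : state d -> R) (z : state d).

Local Notation L := (@generator R d m eps).
Local Notation Q := (@lazy_step R d m eps c^-1).

Lemma generator_sum (n : nat) (r : nat -> R) (g : nat -> state d -> R) z :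
  L (fun z => \sum_(j < n) r j * g j z) z = \sum_(j < n) r j * L (g j) z.
Proof.
rewrite generatorE.
under [RHS]eq_bigr do rewrite generatorE mulr_sumr.
rewrite exchange_big /=; apply: eq_bigr => i _.
by rewrite -sumrB mulr_sumr; apply: eq_bigr => j _; ring.
Qed.

(** Binomial expansion of (1 + L / c)^k. *)
Lemma iter_lazy_step k F z : iter k Q F z =
  \sum_(j < k.+1) ('C(k, j)%:R * c^-1 ^+ j) * iter j L F z.
Proof.
elim: k z => [|k IH] z; first by rewrite big_ord1 bin0 expr0 mulr1 mul1r.
rewrite iterS /lazy_step IH.
have -> : iter k Q F = fun z => \sum_(j < k.+1) ('C(k, j)%:R * c^-1 ^+ j) * iter j L F z.
  exact/funext.
rewrite (generator_sum k.+1 (fun j => 'C(k, j)%:R * c^-1 ^+ j) (fun j => iter j L F)).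
rewrite big_ord_recl /= [RHS]big_ord_recl /= !bin0 -addrA; congr (_ + _).
have -> : \sum_(i < k) 'C(k, bump 0 i)%:R * c^-1 ^+ bump 0 i * L (iter (0 + i) L F) z
  = \sum_(i < k.+1) 'C(k, i.+1)%:R * c^-1 ^+ i.+1 * iter i.+1 L F z.
  by rewrite [RHS]big_ord_recr /= bin_small // !mul0r addr0.
rewrite mulr_sumr -big_split; apply: eq_bigr => i _ /=.
by rewrite /bump /= add1n add0n binS natrD exprS; ring.
Qed.

Lemma iter_generator_bound (K : R) F n z : (forall z, `|F z| <= K) ->
  `|iter n L F z| <= K * (2 * (1 + eps)) ^+ n.
Proof.
move=> FK; elim: n z => [|n IH] z; first by rewrite expr0 mulr1.
rewrite iterS generatorE; apply: (le_trans (ler_norm_sum _ _ _)).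
have -> : K * (2 * (1 + eps)) ^+ n.+1 =
    \sum_(i : jump d) jump_rate m eps i * (2 * (K * (2 * (1 + eps)) ^+ n)).
  by rewrite -mulr_suml (rate_sum m eps d_gt0) exprS; ring.
apply: ler_sum => i _; have r0 := rate_ge0 m i (ltW eps_gt0).
rewrite normrM (ger0_norm r0) ler_wpM2l //.
by apply: (le_trans (ler_normB _ _)); have := IH (st_move i z); have := IH z; lra.
Qed.

(** Uniformization: e^(tL) = e^(- c t) e^(c t (1 + L / c)), where the last
    exponential has nonnegative terms. *)
Lemma semigroup_poisson (K : R) F z (t : R) : 0 <= t -> (forall z, `|F z| <= K) ->
  (fun N => expR (- (c * t)) * \sum_(k < N) exp_coeff (c * t) k * iter k Q F z) @ \oo
    --> semigroup L t F z.
Proof.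
move=> t0 FK; pose al n := t ^+ n / n`!%:R * iter n L F z.
pose y := t * (2 * (1 + eps)).
have y0 : 0 <= y by rewrite !mulr_ge0 // addr_ge0 // ltW.
have ct0 : 0 <= c * t by rewrite mulr_ge0 // ltW.
have alK n : `|al n| <= K * exp_coeff y n.
  rewrite /al normrM ger0_norm ?divr_ge0 ?exprn_ge0 //.
  apply: (@le_trans _ _ (t ^+ n / n`!%:R * (K * (2 * (1 + eps)) ^+ n))).
    by rewrite ler_wpM2l ?divr_ge0 ?exprn_ge0 // iter_generator_bound.
  rewrite (_ : K * exp_coeff y n = t ^+ n / n`!%:R * (K * (2 * (1 + eps)) ^+ n)) //.
  rewrite /exp_coeff /= /y [(t * _) ^+ n]exprMn.
  by move: ((2 * (1 + eps)) ^+ n) => w; ring.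
have lim_al : expR (- (c * t)) * (expR (c * t) * limn (series al)) = semigroup L t F z.
  by rewrite mulrA -expRD addNr expR0 mul1r.
rewrite -lim_al.
apply: (@cvg_trans _ ((fun N => expR (- (c * t)) *
    \sum_(n < N) \sum_(j < n.+1) exp_coeff (c * t) (n - j)%N * al j) @ \oo)); last first.
  by apply: cvgM; [exact: cvg_cst|exact: cvg_exp_convolution alK].
apply: near_eq_cvg; apply: nearW => N /=.
congr (_ * _); apply: eq_bigr => k _; rewrite iter_lazy_step mulr_sumr.
apply: eq_bigr => j _; rewrite /al mulrA [RHS]mulrA; congr (_ * _).
have jk : (j <= k)%N by rewrite -ltnS.
have := bin_fact jk => /(congr1 (fun k => k%:R : R)); rewrite !natrM => E.
have f0 i : i`!%:R != 0 :> R by rewrite pnatr_eq0 -lt0n fact_gt0.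
have ek : (c * t) ^+ k = (c * t) ^+ (k - j) * (c ^+ j * t ^+ j).
  by rewrite -exprMn -exprD subnK.
rewrite /exp_coeff /= -E ek exprVn.
have cN0 : c ^+ j != 0 by rewrite expf_neq0 // gt_eqF.
have bN0 : 'C(k, j)%:R != 0 :> R by rewrite pnatr_eq0 -lt0n bin_gt0.
move: ((c * t) ^+ (k - j)) (c ^+ j) cN0 => u v vN0; field.
by rewrite vN0 !f0 bN0.
Qed.
End Uniformization.

(** * The initial environment *)

(** Arrows, patterns and positions take countably many values, so measurability
    reduces to that of the fibers. *)
Lemma preimage_bigcup_fibers (T : countType) W V (u : W -> T) (h : T -> V) (B : set V) :
  [set w | B (h (u w))] =
  \bigcup_n (if unpickle n is Some y then [set w | u w = y /\ B (h y)] else set0 : set W).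
Proof.
apply/seteqP; split => [w Bw|w [n _]].
  by exists (pickle (u w)) => //; rewrite pickleK.
by case: unpickle => // y [/= <-].
Qed.

Lemma sigma_algebra_fibers (T : countType) W V (G : set (set W)) (u : W -> T) (h : T -> V)
  (B : set V) : sigma_algebra setT G -> (forall y, G [set w | u w = y]) ->
  G [set w | B (h (u w))].
Proof.
move=> [G0 _ GU] Gu; rewrite (preimage_bigcup_fibers u h B); apply: GU => n.
case: unpickle => [y|//]; have [Bh|nBh] := pselect (B (h y)).
  rewrite (_ : [set w | u w = y /\ B (h y)] = [set w | u w = y]) //.
  by apply/seteqP; split => w //= [].
by rewrite (_ : [set w | u w = y /\ B (h y)] = set0) //; apply/seteqP; split => w //= [].
Qed.

Lemma sigma_algebra_measurable disp (W : measurableType disp) :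
  sigma_algebra setT (@measurable disp W).
Proof.
split; first exact: measurable0.
  by move=> A mA; exact: measurableD.
by move=> A mA; exact: bigcupT_measurable.
Qed.

(** The integral of a nonnegative function is a supremum over the simple
    functions below it, hence monotone even among functions that are not known
    to be measurable. *)
Lemma ge0_integral_mono disp (W : measurableType disp) (R : realType)
    (nu : {measure set W -> \bar R}) (D : set W) (f g : W -> \bar R) :
  (forall x, D x -> 0 <= f x)%E -> (forall x, D x -> f x <= g x)%E ->
  (\int[nu]_(x in D) f x <= \int[nu]_(x in D) g x)%E.
Proof.
move=> f0 fg; rewrite !(integral_mkcond D).
have f0' x : (0 <= (f \_ D) x)%E by apply: erestrict_ge0.
have fg' x : ((f \_ D) x <= (g \_ D) x)%E by apply: lee_restrict.
rewrite !ge0_integralTE => [|x|//]; last exact: le_trans (fg' x).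
apply: ereal_sup_le => _ [h /= hf <-]; exists h => //= x.
exact: le_trans (hf x) (fg' x).
Qed.

Section Initial.
Variables (R : realType) (d : nat) (m : model) (eps : R) (p : 'I_d -> R).
Variables (disp : measure_display) (W : measurableType disp) (P : probability W R).
Variables (Z : R -> W -> state d).
Hypotheses (d_gt0 : (0 < d)%N) (hZ : walk m eps p P Z).

Definition init_env (w : W) : env d := (Z 0 w).1.

Definition init_mean (f : env d -> R) : R := \int[P]_w f (init_env w).

Lemma measurable_init_pattern s l : measurable [set w | map (init_env w) s = l].
Proof.
elim: s l => [|x s IH] [|a l].
- rewrite (_ : [set w | _] = setT); [exact: measurableT|by apply/seteqP; split].
- rewrite (_ : [set w | _] = set0); [exact: measurable0|by apply/seteqP; split].
- rewrite (_ : [set w | _] = set0); [exact: measurable0|by apply/seteqP; split].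
rewrite (_ : [set w | _] = (Z 0 @^-1` [set z | z.1 x = a]) `&` [set w | map (init_env w) s = l]).
  apply: measurableI; last exact: IH.
  by apply: (jp_measurable (walk_jump hZ)) => //; left; exists x, a.
apply/seteqP; split => w /= [].
  by move=> <- <-.
by rewrite /init_env => -> ->.
Qed.

Lemma local_measurable (f : env d -> R) : local f ->
  measurable_fun setT (fun w => f (init_env w)).
Proof.
move=> [s fs] _ B mB; rewrite setTI.
rewrite (_ : _ @^-1` B = [set w | B (f (pattern_env d_gt0 s (map (init_env w) s)))]).
  apply: (@sigma_algebra_fibers _ _ _ _ (fun w => map (init_env w) s)
    (fun l => f (pattern_env d_gt0 s l))); first exact: sigma_algebra_measurable.
  exact: measurable_init_pattern.
have E w : f (pattern_env d_gt0 s (map (init_env w) s)) = f (init_env w).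
  by apply: fs => x xs; rewrite pattern_env_map.
by apply/seteqP; split => w /=; rewrite E.
Qed.

Lemma local_bounded (f : env d -> R) : local f -> exists K, forall om, `|f om| <= K.
Proof.
move=> [s fs].
exists (\sum_(t : (size s).-tuple (arrow d)) `|f (pattern_env d_gt0 s t)|) => om.
rewrite (pattern_decomp d_gt0 om fs); apply: (le_trans (ler_norm_sum _ _ _)).
apply: ler_sum => t _; rewrite normrM ler_piMr // /cyl_indic.
by case: eqP => _; rewrite ?normr1 ?normr0.
Qed.

Lemma local_integrable (f : env d -> R) : local f ->
  P.-integrable setT (EFin \o (fun w => f (init_env w))).
Proof.
move=> fL; apply: measurable_bounded_integrable => //.
- by rewrite (le_lt_trans (probability_le1 P measurableT)) ?ltry.
- exact: local_measurable.
have [K fK] := local_bounded fL; exists K; split; first exact: num_real.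
by move=> x Kx w _ /=; apply: le_trans (ltW Kx).
Qed.

Lemma local_integralE (f : env d -> R) : local f ->
  (\int[P]_w (f (init_env w))%:E = (init_mean f)%:E)%E.
Proof.
by move=> fL; rewrite /init_mean /Rintegral fineK //; exact: integrable_fin_num (local_integrable fL).
Qed.

Lemma init_pi_expectation : pi_expectation p init_mean.
Proof.
split.
- move=> a f g fL gL; rewrite /init_mean.
  rewrite RintegralD //; last 2 first.
  + exact: (local_integrable (localZ a fL)).
  + exact: local_integrable.
  by rewrite RintegralZl //; exact: local_integrable.
- by move=> f _ f0; apply: Rintegral_ge0.
move=> s a us; pose A := [set w | forall x, x \in s -> (Z 0 w).1 x = a x].
have PA : P A = (\prod_(x <- s) mu p (a x))%:E := walk_init_env hZ a us.
have mA : measurable [set w | map (init_env w) s = map a s] by exact: measurable_init_pattern.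
have -> : init_mean (cyl_indic R s (map a s)) = \int[P]_w \1_[set w | map (init_env w) s = map a s] w.
  rewrite /init_mean; apply: eq_Rintegral => w _; rewrite /cyl_indic indicE.
  by congr (nat_of_bool _)%:R; apply/eqP/idP; rewrite inE.
rewrite /Rintegral integral_indic // setIT.
have -> : [set w | map (init_env w) s = map a s] = A; last exact: (congr1 fine PA).
apply/seteqP; split => w /=; rewrite /A /=.
  by move=> /eq_in_map E x xs; exact: E.
by move=> E; apply/eq_in_map => x xs; exact: E.
Qed.
End Initial.

(** * Truncation of the squared distance *)

Section LazyWalk.
Variables (R : realType) (d : nat) (m : model) (eps th : R).
Hypotheses (d_gt0 : (0 < d)%N) (eps_gt0 : 0 < eps) (th_gt0 : 0 < th).
Hypothesis (th_eps : th * (1 + 2 * eps) <= 1).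
Implicit Types (F G : state d -> R) (z : state d).
Local Notation Q := (@lazy_step R d m eps th).

Lemma lazy_stepE F z :
  Q F z = (1 - th * (1 + eps)) * F z + th * \sum_i jump_rate m eps i * F (st_move i z).
Proof.
rewrite /lazy_step generatorE; under eq_bigr do rewrite mulrBr.
by rewrite sumrB -mulr_suml (rate_sum m eps d_gt0); ring.
Qed.

Lemma lazy_step_le F G z : (forall z, F z <= G z) -> Q F z <= Q G z.
Proof.
move=> FG; rewrite !lazy_stepE lerD // ler_wpM2l ?(ltW th_gt0) //.
  by rewrite subr_ge0; apply: (th_rate eps_gt0 th_gt0 th_eps).
by apply: ler_sum => i _; rewrite ler_wpM2l // rate_ge0 // ltW.
Qed.

Lemma iter_lazy_step_le k F G z : (forall z, F z <= G z) -> iter k Q F z <= iter k Q G z.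
Proof. by move=> FG; elim: k z => [|k IH] z //=; exact: lazy_step_le. Qed.

Lemma iter_lazy_step_ge0 k F z : (forall z, 0 <= F z) -> 0 <= iter k Q F z.
Proof.
move=> F0; have E z' : iter k Q (fun=> 0) z' = 0.
  elim: k z' => [|k IH] z' //=; rewrite lazy_stepE IH mulr0 add0r big1 ?mulr0 // => i _.
  by rewrite IH mulr0.
by rewrite -(E z); exact: iter_lazy_step_le.
Qed.

(** A move sends the walker to one of finitely many positions, according to the
    arrow followed. *)
Lemma iter_lazy_step_local k F x : (forall x, local (fun om => F (om, x))) ->
  local (fun om => iter k Q F (om, x)).
Proof.
move=> FL; elim: k x => [|k IH] x //=.
rewrite (_ : (fun om => _) = fun om => (1 - th * (1 + eps)) * iter k Q F (om, x) +
  th * \sum_i jump_rate m eps i * iter k Q F (st_move i (om, x))); last first.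
  by apply/funext => om; rewrite lazy_stepE.
apply: localD; first exact: localZ.
apply: localZ; apply: local_sum => i _; apply: localZ.
rewrite (_ : (fun om => _) = fun om => \sum_a (move_arrow i om == a)%:R *
    iter k Q F (env_move i om, x + arrow_vec a)).
  apply: local_sum => a _; apply: localM.
    exact: (local_move_arrow (R := R) i (fun b => (b == a)%:R)).
  exact: (local_comp (f := fun om => iter k Q F (om, x + arrow_vec a)) (IH _)
    (@local_env_move d i)).
apply/funext => om; rewrite (bigD1 (move_arrow i om)) //= eqxx mul1r big1 ?addr0 //.
by move=> a /negPf ia; rewrite eq_sym ia mul0r.
Qed.

(** A bounded substitute for |x|^2, to which the Markov property applies. *)
Definition truncated_sqnorm (M : R) z : R := Num.min (sqnorm R z.2) M.

Lemma sqnorm_ge0 (x : 'rV[int]_d) : 0 <= sqnorm R x.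
Proof. by apply: sumr_ge0 => i _; exact: sqr_ge0. Qed.

Lemma truncated_sqnorm_ge0 M z : 0 <= M -> 0 <= truncated_sqnorm M z.
Proof. by move=> M0; rewrite /truncated_sqnorm le_min sqnorm_ge0 M0. Qed.

Lemma truncated_sqnorm_le M z : truncated_sqnorm M z <= sqnorm R z.2.
Proof. by rewrite /truncated_sqnorm ge_min lexx. Qed.

Lemma sqnorm_step (x : 'rV[int]_d) a n : sqnorm R x <= n%:R ^+ 2 ->
  sqnorm R (x + arrow_vec a) <= n.+1%:R ^+ 2.
Proof.
move=> xn; rewrite arrow_comp_sqnorm.
rewrite (bigD1 a.1) //= big1 ?addr0 => [|j /negPf ja]; last first.
  by rewrite arrow_compE ja mulr0.
have x1 : (x ord0 a.1)%:~R ^+ 2 <= n%:R ^+ 2 :> R.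
  apply: le_trans xn; rewrite /sqnorm (bigD1 a.1) //= lerDl.
  by apply: sumr_ge0 => i _; exact: sqr_ge0.
have n0 : 0 <= n%:R :> R by [].
have c2 : arrow_comp R a.1 a ^+ 2 <= 1 by rewrite arrow_comp_sqr eqxx.
move: x1 c2 xn; rewrite -(natr1 n); move: (_%:~R) (arrow_comp _ _ _) (sqnorm _ _) n%:R n0.
move=> y e s u u0 yu e1 su.
have ye : (y * e) ^+ 2 <= u ^+ 2.
  by rewrite exprMn; apply: le_trans yu; rewrite ler_piMr ?sqr_ge0.
have : y * e <= u by rewrite leNgt; apply/negP => lt; nra.
nra.
Qed.

(** A walk started within distance n stays within distance n + k for k steps. *)
Lemma iter_truncated_sqnorm k n om x (M : R) : sqnorm R x <= n%:R ^+ 2 ->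
  (n + k)%:R ^+ 2 <= M ->
  iter k Q (truncated_sqnorm M) (om, x) = iter k Q (fun z => sqnorm R z.2) (om, x).
Proof.
elim: k n om x => [|k IH] n om x xn nM /=.
  by rewrite /truncated_sqnorm min_l //= (le_trans xn) // -[n in leLHS]addn0.
rewrite !lazy_stepE (IH n) //; last first.
  by apply: le_trans nM; rewrite -!natrX ler_nat leq_exp2r // addnS.
congr (_ + _ * _); apply: eq_bigr => i _; congr (_ * _).
by apply: (IH n.+1); rewrite ?addSnnS //; exact: sqnorm_step.
Qed.
End LazyWalk.

(** * Linear bounds on the mean-square displacement *)

Section MeanSquare.
Variables (R : realType) (d : nat) (m : model) (eps : R) (p : 'I_d -> R).
Variables (disp : measure_display) (W : measurableType disp) (P : probability W R).
Variables (Z : R -> W -> state d).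
Hypotheses (hd : (3 <= d)%N) (eps_gt0 : 0 < eps) (hZ : walk m eps p P Z).

Let d_gt0 : (0 < d)%N := leq_trans (isT : (0 < 3)%N) hd.
Local Notation Ex := (init_mean P Z).
Let ExP := init_pi_expectation d_gt0 hZ.

(* The rate of the Poisson clock: at least 1 + 2 eps, so that 1 - th + th eps U
   is nonnegative, and at least d, for the lower bound in M2. *)
Let c : R := 1 + 2 * eps + d%:R.
Let c_gt0 : 0 < c.
Proof. by rewrite !addr_gt0 ?mulr_gt0 // ltr0n. Qed.
Let th := c^-1.
Let th_gt0 : 0 < th. Proof. by rewrite invr_gt0. Qed.
Let th_eps : th * (1 + 2 * eps) <= 1.
Proof. by rewrite mulrC ler_pdivrMr // mul1r /c lerDl. Qed.
Let th_d : th * d%:R <= 1.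
Proof. by rewrite mulrC ler_pdivrMr // mul1r /c lerDr addr_ge0 // mulr_ge0 // ltW. Qed.

Local Notation Q := (@lazy_step R d m eps th).
Local Notation sq := (fun z : state d => sqnorm R z.2).
Local Notation trunc := (@truncated_sqnorm R d).

Definition poisson_sum (t : R) N (F : state d -> R) (om : env d) : R :=
  expR (- (c * t)) * \sum_(k < N) exp_coeff (c * t) k * iter k Q F (om, 0).

Lemma init_state w : Z 0 w = (init_env Z w, 0).
Proof. by rewrite /init_env -(walk_init_pos hZ w); case: (Z 0 w). Qed.

Lemma truncated_bound M : 0 <= M -> forall z : state d, `|trunc M z| <= M.
Proof.
move=> M0 z; rewrite ger0_norm ?truncated_sqnorm_ge0 //.
by rewrite /truncated_sqnorm ge_min lexx orbT.
Qed.

Lemma truncated_measurable M : state_measurable_fun (trunc M).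
Proof.
move=> B _.
apply: (@sigma_algebra_fibers _ _ _ _ (fun z : state d => z.2)
   (fun x => Num.min (sqnorm R x) M)); first exact: smallest_sigma_algebra.
by move=> y G [_]; apply; right; exists y.
Qed.

Lemma truncated_mean M t : 0 <= M -> 0 <= t ->
  (\int[P]_w (trunc M (Z t w))%:E =
   \int[P]_w (semigroup (generator m eps) t (trunc M) (init_env Z w, 0))%:E)%E.
Proof.
move=> M0 t0.
have HT : history Z 0 setT.
  rewrite -(setD0 setT) => G [[G0 GD _] _]; exact: GD.
have := jp_markov (walk_jump hZ) (lexx 0) t0 HT (truncated_measurable M)
  (ex_intro _ M (truncated_bound M0)).
rewrite subr0 => ->; apply: eq_integral => w _; by rewrite init_state.
Qed.

Lemma poisson_sum_cvg M t om : 0 <= M -> 0 <= t ->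
  (fun N => poisson_sum t N (trunc M) om) @ \oo -->
  semigroup (generator m eps) t (trunc M) (om, 0).
Proof.
move=> M0 t0.
exact: (semigroup_poisson d_gt0 eps_gt0 c_gt0 t0 (truncated_bound M0)).
Qed.

Lemma poisson_sum_mono M t om : 0 <= M -> 0 <= t ->
  {homo (fun N => poisson_sum t N (trunc M) om) : n k / (n <= k)%N >-> n <= k}.
Proof.
move=> M0 t0; apply/nondecreasing_seqP => N.
rewrite /poisson_sum ler_wpM2l ?expR_ge0 // big_ord_recr /= lerDl mulr_ge0 //.
  by rewrite exp_coeff_ge0 // mulr_ge0 // ltW.
apply: (iter_lazy_step_ge0 m d_gt0 eps_gt0 th_gt0 th_eps) => z.
exact: truncated_sqnorm_ge0.
Qed.

Lemma poisson_sum_ge0 M t om N : 0 <= M -> 0 <= t -> 0 <= poisson_sum t N (trunc M) om.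
Proof.
move=> M0 t0; apply: le_trans (poisson_sum_mono om M0 t0 (leq0n N)).
by rewrite /poisson_sum big_ord0 mulr0.
Qed.

Lemma poisson_sum_local M t N : local (poisson_sum t N (trunc M)).
Proof.
apply: localZ; apply: local_sum => k _; apply: localZ.
by apply: iter_lazy_step_local => // x; exists [::].
Qed.

Definition gain_sum (t : R) N (om : env d) : R :=
  expR (- (c * t)) * \sum_(k < N) exp_coeff (c * t) k * gain m eps th k om.

Lemma iter_sqnorm0 k om : iter k Q sq (om, 0) = gain m eps th k om.
Proof.
rewrite iter_sqnorm //= /sqnorm !big1 ?mulr0 ?add0r // => j _; rewrite mxE ?mul0r //.
by rewrite expr0n.
Qed.

Lemma gain_sum_local t N : local (gain_sum t N).
Proof. by apply: localZ; apply: local_sum => k _; apply: localZ; exact: gain_local. Qed.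

Lemma ex_gain_sum t N : Ex (gain_sum t N) =
  expR (- (c * t)) * \sum_(k < N) exp_coeff (c * t) k * Ex (gain m eps th k).
Proof.
have gL k : local (fun om => exp_coeff (c * t) k * gain m eps th k om).
  by apply: localZ; exact: gain_local.
rewrite (exZ ExP); last exact: local_sum.
rewrite (ex_sum ExP) //; congr (_ * _); apply: eq_bigr => k _.
by rewrite (exZ ExP) //; exact: gain_local.
Qed.

Lemma poisson_first_moment (x : R) N :
  \sum_(k < N.+1) exp_coeff x k * k%:R = x * series (exp_coeff x) N.
Proof.
rewrite big_ord_recl mulr0 add0r /series /= big_mkord mulr_sumr.
apply: eq_bigr => k _; rewrite /exp_coeff /= exprS factS natrM invfM.
have k0 : k.+1%:R != 0 :> R by rewrite pnatr_eq0.
have f0 : k`!%:R != 0 :> R by rewrite pnatr_eq0 -lt0n fact_gt0.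
by rewrite /bump /= add1n; field; rewrite ?natr1 ?nat1r k0 f0.
Qed.

Lemma poisson_mass_le1 t N : 0 <= t ->
  expR (- (c * t)) * series (exp_coeff (c * t)) N <= 1.
Proof.
move=> t0; have ct0 : 0 <= c * t by rewrite mulr_ge0 // ltW.
rewrite expRN mulrC ler_pdivrMr ?expR_gt0 // mul1r.
apply: nondecreasing_cvgn_le; last exact: is_cvg_series_exp_coeff.
by apply: nondecreasing_series => n _ _; exact: exp_coeff_ge0.
Qed.

Definition diffusion_bound : R := gain_rate d eps th * c.

(** The Poisson averages of nonnegative functions increase to the semigroup, so
    monotone convergence allows to take the mean over the initial environment
    term by term. Each term is at most the untruncated one, bounded linearly in
    the number of steps. *)
Lemma truncated_mean_upper M t : 0 <= M -> 0 <= t ->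
  (\int[P]_w (trunc M (Z t w))%:E <= (diffusion_bound * t)%:E)%E.
Proof.
move=> M0 t0; rewrite truncated_mean //.
have ct0 : 0 <= c * t by rewrite mulr_ge0 // ltW.
have gr0 : 0 <= gain_rate d eps th.
  have := le_trans (gain_lower ExP hd m eps_gt0 th_gt0 th_eps th_d 1)
     (gain_upper ExP hd m eps_gt0 th_gt0 th_eps 1).
  by rewrite !mulr1; apply: le_trans; rewrite mulr_ge0 // ltW.
pose S N w := (poisson_sum t N (trunc M) (init_env Z w))%:E.
have lim_S w : limn (S^~ w) = (semigroup (generator m eps) t (trunc M) (init_env Z w, 0))%:E.
  by apply/cvg_lim => //; apply/fine_cvgP; split; [exact: nearW|exact: poisson_sum_cvg].
under eq_integral do rewrite -lim_S.
rewrite monotone_convergence //; last 3 first.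
- move=> N; apply/measurable_EFinP.
  exact: (local_measurable d_gt0 hZ (poisson_sum_local M t N)).
- by move=> N w _; rewrite lee_fin poisson_sum_ge0.
- by move=> w _ n k nk; rewrite lee_fin; exact: poisson_sum_mono.
apply: lime_le.
  apply: ereal_nondecreasing_is_cvgn => n k nk.
  apply: ge0_integral_mono => w _; first by rewrite lee_fin poisson_sum_ge0.
  by rewrite lee_fin; exact: poisson_sum_mono.
apply: nearW => N.
have -> : (\int[P]_w S N w = (Ex (poisson_sum t N (trunc M)))%:E)%E.
  exact: (local_integralE d_gt0 hZ (poisson_sum_local M t N)).
rewrite lee_fin.
apply: (@le_trans _ _ (Ex (gain_sum t N))).
  apply: (ex_le ExP) => [||om]; [exact: poisson_sum_local|exact: gain_sum_local|].
  rewrite ler_wpM2l ?expR_ge0 //; apply: ler_sum => k _.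
  rewrite ler_wpM2l ?exp_coeff_ge0 // -iter_sqnorm0.
  apply: (iter_lazy_step_le m d_gt0 eps_gt0 th_gt0 th_eps) => z.
  exact: truncated_sqnorm_le.
rewrite ex_gain_sum.
have bound : \sum_(k < N) exp_coeff (c * t) k * Ex (gain m eps th k) <=
    gain_rate d eps th * \sum_(k < N.+1) exp_coeff (c * t) k * k%:R.
  rewrite big_ord_recr /= mulrDr mulr_sumr -[leLHS]addr0 lerD //; last first.
    by apply: mulr_ge0 => //; apply: mulr_ge0 => //; exact: exp_coeff_ge0.
  apply: ler_sum => k _; rewrite mulrCA ler_wpM2l ?exp_coeff_ge0 //.
  exact: (gain_upper ExP hd m eps_gt0 th_gt0 th_eps).
apply: (le_trans (ler_wpM2l (expR_ge0 _) bound)).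
rewrite poisson_first_moment.
have -> : expR (- (c * t)) * (gain_rate d eps th * (c * t * series (exp_coeff (c * t)) N)) =
  diffusion_bound * t * (expR (- (c * t)) * series (exp_coeff (c * t)) N).
  by rewrite /diffusion_bound; ring.
by rewrite ler_piMr ?poisson_mass_le1 // /diffusion_bound !mulr_ge0 // ltW.
Qed.

Lemma msdE t : msd P Z t = (\int[P]_w (sq (Z t w))%:E)%E.
Proof. by rewrite /msd unlock. Qed.

Lemma msd_upper t : 0 <= t -> (msd P Z t <= (diffusion_bound * t)%:E)%E.
Proof.
move=> t0; rewrite msdE.
pose S (N : nat) w := (trunc N%:R (Z t w))%:E.
have S_mono w : {homo S^~ w : n k / (n <= k)%N >-> (n <= k)%E}.
  by move=> n k nk; rewrite lee_fin /truncated_sqnorm le_min2 // ler_nat.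
have lim_S w : limn (S^~ w) = (sq (Z t w))%:E.
  apply/cvg_lim => //; apply: cvg_near_cst; near=> N.
  rewrite /S /truncated_sqnorm min_l //.
  by near: N; exact: nbhs_infty_ger.
under eq_integral do rewrite -lim_S.
rewrite monotone_convergence //; last 2 first.
- move=> N; apply/measurable_EFinP => _ B mB; rewrite setTI.
  apply: (@sigma_algebra_fibers _ _ _ _ (fun w => (Z t w).2)
    (fun x => Num.min (sqnorm R x) N%:R)); first exact: sigma_algebra_measurable.
  move=> y; apply: (jp_measurable (walk_jump hZ) t0 (B := [set z | z.2 = y])).
  by right; exists y.
- by move=> N w _; rewrite lee_fin truncated_sqnorm_ge0.
apply: lime_le.
  apply: ereal_nondecreasing_is_cvgn => n k nk.
  apply: ge0_integral_mono => w _; last exact: S_mono.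
  by rewrite lee_fin truncated_sqnorm_ge0.
by apply: nearW => N; exact: truncated_mean_upper.
Unshelve. all: by end_near. Qed.

(** Keeping only the first N terms of the Poisson average, a truncation level
    above N^2 has no effect on them; then N tends to infinity. *)
Lemma msd_lower t : 0 <= t -> ((eps * t)%:E <= msd P Z t)%E.
Proof.
move=> t0; rewrite msdE.
have ct0 : 0 <= c * t by rewrite mulr_ge0 // ltW.
have bound N : ((eps * t * (expR (- (c * t)) * series (exp_coeff (c * t)) N))%:E
    <= \int[P]_w (sq (Z t w))%:E)%E.
  (* The terms of index at most N see positions at distance at most N. *)
  pose M : R := N.+1%:R ^+ 2.
  have M0 : 0 <= M by exact: sqr_ge0.
  apply: (@le_trans _ _ (\int[P]_w (trunc M (Z t w))%:E)%E); last first.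
    apply: ge0_integral_mono => w _; rewrite lee_fin ?truncated_sqnorm_ge0 //.
    exact: truncated_sqnorm_le.
  rewrite truncated_mean //.
  apply: (@le_trans _ _ (\int[P]_w (gain_sum t N.+1 (init_env Z w))%:E)%E); last first.
    have E om : gain_sum t N.+1 om = poisson_sum t N.+1 (trunc M) om.
      congr (_ * _); apply: eq_bigr => k _; rewrite -iter_sqnorm0; congr (_ * _).
      symmetry; apply: (@iter_truncated_sqnorm _ _ _ _ _ d_gt0 _ 0).
        by rewrite /sqnorm big1 // => i _; rewrite mxE expr0n.
      by rewrite add0n /M -!natrX ler_nat leq_exp2r // ltnW.
    apply: ge0_integral_mono => w _; rewrite lee_fin E; first exact: poisson_sum_ge0.
    rewrite -(cvg_lim _ (poisson_sum_cvg (om := init_env Z w) M0 t0)) //.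
    apply: nondecreasing_cvgn_le; first exact: poisson_sum_mono.
    by apply/cvg_ex; eexists; exact: poisson_sum_cvg.
  rewrite (local_integralE d_gt0 hZ (gain_sum_local t N.+1)) lee_fin ex_gain_sum.
  have -> : eps * t * (expR (- (c * t)) * series (exp_coeff (c * t)) N) =
     expR (- (c * t)) * (th * eps * (c * t * series (exp_coeff (c * t)) N)).
    by rewrite /th; field; rewrite gt_eqF.
  rewrite ler_wpM2l ?expR_ge0 // -poisson_first_moment mulr_sumr.
  apply: ler_sum => k _; rewrite mulrCA ler_wpM2l ?exp_coeff_ge0 //.
  exact: (gain_lower ExP hd m eps_gt0 th_gt0 th_eps th_d).
have lim1 : (fun N => eps * t * (expR (- (c * t)) * series (exp_coeff (c * t)) N)) @ \oo
    --> eps * t.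
  have e1 : eps * t = eps * t * (expR (- (c * t)) * expR (c * t)).
    by rewrite -expRD addNr expR0 mulr1.
  rewrite [X in _ --> X]e1.
  apply: cvgM; first exact: cvg_cst.
  by apply: cvgM; [exact: cvg_cst|exact: is_cvg_series_exp_coeff].
move: bound; case: (\int[P]_w _)%E => [r| |] bound; last 2 first.
- by rewrite leey.
- by have := bound 0%N.
rewrite lee_fin -(cvg_lim _ lim1) //.
apply: limr_le; first by apply/cvg_ex; eexists; exact: lim1.
by apply: nearW => N; rewrite -lee_fin.
Qed.
End MeanSquare.

(** * Laplace transforms of linearly bounded functions *)

Section Laplace.
Variable R : realType.
Implicit Types (a l : R).

Lemma is_derive_affine (k b t : R) : is_derive t 1 (fun s : R => k * s + b) k.
Proof.
apply: (@is_derive_eq _ _ _ (k *: id + cst b) t 1 k (k *: 1 + 0)).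
by rewrite addr0 /GRing.scale /= mulr1.
Qed.

Lemma is_derive_exp_primitive a l (t : R) : 0 < l ->
  is_derive t 1 (fun s : R => (- (a / l) * s + - (a / l ^+ 2)) * expR (- l * s))
    (a * t * expR (- l * t)).
Proof.
move=> l0; have lN0 : l != 0 by rewrite gt_eqF.
have dexp : is_derive t 1 (fun s : R => expR (- l * s)) (expR (- l * t) * - l).
  have h : is_derive t 1 (fun s : R => - l * s) (- l).
    apply: (@is_derive_eq _ _ _ (- l *: id) t 1 (- l) (- l *: 1)).
    by rewrite /GRing.scale /= mulr1.
  exact: (is_derive1_comp (is_derive_expR _) h).
have dlin := is_derive_affine (- (a / l)) (- (a / l ^+ 2)) t.
apply: (is_derive_eq (is_deriveM dlin dexp)).
by rewrite /GRing.scale /=; field.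
Qed.

(** Since 1 + l s <= 2 e^(l s / 2), the primitive decays at least like
    e^(- l s / 2). *)
Lemma cvg_exp_primitive a l : 0 <= a -> 0 < l ->
  (fun s : R => (- (a / l) * s + - (a / l ^+ 2)) * expR (- l * s)) s @[s --> +oo] --> (0 : R).
Proof.
move=> a0 l0; have lN0 : l != 0 by rewrite gt_eqF.
have lim : (fun s : R => 2 * (a / l ^+ 2) * expR (- (l / 2 * s))) s @[s --> +oo] --> (0 : R).
  rewrite -[X in _ --> X](mulr0 (2 * (a / l ^+ 2))); apply: cvgM; first exact: cvg_cst.
  rewrite (_ : (fun s : R => _) = (fun u : R => expR (- u)) \o (fun s : R => l / 2 * s)) //.
  apply: (@cvg_comp _ _ _ _ _ _ (pinfty_nbhs R)); last exact: cvgr_expR.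
  by apply: gt0_cvgMry => //; rewrite divr_gt0.
apply/cvgr0Pnorm_le => e e0; near=> s.
have s0 : 0 <= s by near: s; exact: nbhs_pinfty_ge.
have small : 2 * (a / l ^+ 2) * expR (- (l / 2 * s)) <= e.
  apply: le_trans (ler_norm _) _; near: s; exact: cvgr0_norm_le lim e e0.
apply: le_trans small.
have -> : (- (a / l) * s + - (a / l ^+ 2)) * expR (- l * s) =
  - (a / l ^+ 2 * (1 + l * s) * expR (- l * s)) by field.
have al0 : 0 <= a / l ^+ 2 by rewrite divr_ge0 // sqr_ge0.
rewrite normrN ger0_norm; last first.
  by rewrite mulr_ge0 ?expR_ge0 // mulr_ge0 // addr_ge0 // mulr_ge0 // ltW.
have -> : - l * s = - (l / 2 * s) + - (l / 2 * s) by field.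
rewrite expRD mulrA ler_pM2r ?expR_gt0 // -mulrA [leRHS]mulrC ler_wpM2l //.
rewrite expRN mulrC ler_pdivrMl ?expR_gt0 //.
by have := expR_ge1Dx (l / 2 * s); lra.
Unshelve. all: by end_near. Qed.

Lemma laplace_linear a l : 0 <= a -> 0 < l ->
  (\int[lebesgue_measure]_(t in `[0%R, +oo[) (a * t * expR (- l * t))%:E = (a * l ^- 2)%:E)%E.
Proof.
move=> a0 l0.
pose F := fun s : R => (- (a / l) * s + - (a / l ^+ 2)) * expR (- l * s).
have dF t := is_derive_exp_primitive a t l0.
have cF : continuous F.
  move=> t; apply: differentiable_continuous; apply/derivable1_diffP.
  by have [] := dF t.
rewrite (@ge0_continuous_FTC2y _ _ F _ 0) //.
- by rewrite sub0e -EFinN /F !mulr0 add0r expR0 mulr1 opprK.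
- by move=> t t0; rewrite mulr_ge0 ?expR_ge0 // mulr_ge0.
- apply: continuous_subspaceT => t.
  apply: cvgM.
    by apply: cvgM; [exact: cvg_cst|exact: cvg_id].
  apply: (@continuous_comp _ _ _ (fun s : R => - l * s) expR); last exact: continuous_expR.
  by apply: cvgM; [exact: cvg_cst|exact: cvg_id].
- exact: cvg_exp_primitive.
- by apply: cvg_at_right_filter; exact: cF.
- by move=> t _; rewrite derive1E; have [_] := dF t.
Qed.

Lemma laplace_bounds (f : R -> \bar R) a b l : 0 <= a -> 0 <= b -> 0 < l ->
  (forall t, 0 <= t -> ((a * t)%:E <= f t <= (b * t)%:E)%E) ->
  ((a * l ^- 2)%:E <= laplace f l <= (b * l ^- 2)%:E)%E.
Proof.
move=> a0 b0 l0 fab.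
have in0 t : `[0, +oo[%classic t -> 0 <= t by rewrite /= in_itv /= andbT.
rewrite -!laplace_linear // /laplace; apply/andP; split.
  apply: ge0_integral_mono => t /in0 t0.
    by rewrite lee_fin mulr_ge0 ?expR_ge0 // mulr_ge0.
  by rewrite EFinM lee_wpmul2r ?lee_fin ?expR_ge0 //; have /andP[] := fab t t0.
apply: ge0_integral_mono => t /in0 t0; have /andP[fa fb] := fab t t0.
  rewrite mule_ge0 ?lee_fin ?expR_ge0 //.
  by apply: le_trans fa; rewrite lee_fin mulr_ge0.
by rewrite [leRHS]EFinM lee_wpmul2r ?lee_fin ?expR_ge0.
Qed.
End Laplace.

Theorem theorem1p10 (R : realType) (d : nat) (hd : (3 <= d)%N)
    (eps : R) (heps : 0 < eps) (p : 'I_d -> R) (hp : in_simplex p)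
    (m : model) (disp : measure_display) (W : measurableType disp)
    (P : probability W R) (Z : R -> W -> state d)
    (hZ : walk m eps p P Z) :
  (exists C D : R, [/\ 0 < C, 0 < D &
     \forall lambda \near (0 : R)^'+,
       ((C * lambda ^- 2)%:E <= laplace (msd P Z) lambda
                             <= (D * lambda ^- 2)%:E)%E])
  /\
  (exists C' D' : R, [/\ 0 < C', 0 < D' &
     \forall t \near (+oo : set_system R),
       ((C' * t)%:E <= msd P Z t <= (D' * t)%:E)%E]).
Proof.
pose D := diffusion_bound d eps.
have bounds t : 0 <= t -> ((eps * t)%:E <= msd P Z t <= (D * t)%:E)%E.
  by move=> t0; rewrite (msd_lower hd heps hZ t0) (msd_upper hd heps hZ t0).
have D0 : 0 < D.
  have /andP[lo up] := bounds 1 ler01; have := le_trans lo up.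
  by rewrite lee_fin !mulr1; exact: lt_le_trans.
split; exists eps, D; split => //.
  near=> l; apply: laplace_bounds; rewrite ?(ltW heps) ?(ltW D0) //.
near=> t; apply: bounds.
by near: t; exact: nbhs_pinfty_ge.
Unshelve. all: by end_near. Qed.
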